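(* Let $k$ be an infinite field with $\mathrm{char}(k)\neq 2,3$ and $V_2$ a $2$-dimensional $k$-vector space with basis $\{e_1,e_2\}$. The linear map $\det^{S^3}:V_2^{\otimes 20}\to k$ is the unique (up to a constant) nontrivial linear map on $V_2^{\otimes 20}$ with the property that $\det^{S^3}(\otimes_{1\le i<j<k\le 6}(v_{i,j,k}))=0$ whenever there exist $1\le x<y<z<t\le 6$ with $v_{x,y,z}=v_{x,y,t}=v_{x,z,t}=v_{y,z,t}$. In particular, $\det^{S^3}$ induces a unique (up to a constant) nontrivial linear map $\Lambda^{S^3}_{V_2}[6]\to k$.
   Context: Tensors in $V_2^{\otimes 20}$ have factors indexed by the triples $(i,j,k)$, $1\le i<j<k\le 6$; simple tensors are written $\otimes_{1\le i<j<k\le 6}(v_{i,j,k})$. $\mathcal{E}^{S^3}_{V_2}[6]$ is the subspace spanned by simple tensors for which there exist $1\le x<y<z<t\le 6$ with $v_{x,y,z}=v_{x,y,t}=v_{x,z,t}=v_{y,z,t}$, and $\Lambda^{S^3}_{V_2}[6]=V_2^{\otimes 20}/\mathcal{E}^{S^3}_{V_2}[6]$. $K_6^3$ is the complete $3$-uniform hypergraph on $\{1,\dots,6\}$ (hyperedges: all $20$ three-element subsets). A homogeneous $2$-partition is an ordered pair $(\mathcal{H}_1,\mathcal{H}_2)$ of disjoint sets of hyperedges with union all hyperedges and $|\mathcal{H}_1|=|\mathcal{H}_2|=10$; $\mathcal{P}_2^h(K_6^3)$ is the set of these. For $\mathcal{P}\in\mathcal{P}_2^h(K_6^3)$ and $1\le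 x<y<z<t\le6$, $\mathrm{Pair}(\mathcal{P},(x,y,z,t))$ is the set of homogeneous $2$-partitions coinciding with $\mathcal{P}$ except possibly on the hyperedges $\{x,y,z\},\{x,y,t\},\{x,z,t\},\{y,z,t\}$. Let $\varepsilon^{S^3}:\mathcal{P}_2^h(K_6^3)\to\{-4,-1,0,1\}$ be the unique map such that $\sum_{\mathcal{K}\in\mathrm{Pair}(\mathcal{P},(x,y,z,t))}\varepsilon^{S^3}(\mathcal{K})=0$ for all $\mathcal{P}$ and all $x<y<z<t$, and $\varepsilon^{S^3}(\mathcal{P}^{(1)})=1$ for $\mathcal{P}^{(1)}$ with $\mathcal{H}_1=\{\{1,2,3\},\{1,2,4\},\{1,3,4\},\{1,2,5\},\{3,4,5\},\{1,5,6\},\{2,4,6\},\{2,5,6\},\{3,4,6\},\{4,5,6\}\}$. A homogeneous $2$-partition $(\mathcal{H}_1,\mathcal{H}_2)$ is called nontrivial if for no $i\in\{1,2\}$ does $\mathcal{H}_i$ contain any of the following configurations (letters denoting distinct elements of $\{1,\dots,6\}$): (a) $\{x,y,z\},\{x,y,t\},\{x,z,t\},\{y,z,t\}$; (b) $\{x,y,z\},\{x,y,t\},\{x,z,t\},\{y,z,u\},\{y,t,u\},\{z,t,u\}$; (c) $\{x,y,u\},\{x,y,v\},\{y,z,u\},\{x,z,u\},\{x,t,v\},\{y,t,v\},\{y,z,t\},\{x,z,t\}$; (d) $\{x,y,z\},\{x,y,t\},\{x,z,t\},\{x,y,u\},\{y,t,u\},\{x,y,v\},\{x,u,v\},\{y,z,v\},\{z,t,v\},\{t,u,v\}$;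 $\mathcal{P}_2^{h,nt}(K_6^3)$ denotes the set of nontrivial ones. For $v_{i,j,k}=\alpha_{i,j,k}e_1+\beta_{i,j,k}e_2$, set $M_{(\mathcal{H}_1,\mathcal{H}_2)}((v_{i,j,k}))=\prod_{\{a,b,c\}\in\mathcal{H}_1}\alpha_{a,b,c}\prod_{\{a,b,c\}\in\mathcal{H}_2}\beta_{a,b,c}$, and let $\det^{S^3}:V_2^{\otimes 20}\to k$ be the linear map with $\det^{S^3}(\otimes_{1\le i<j<k\le 6}(v_{i,j,k}))=\sum_{(\mathcal{H}_1,\mathcal{H}_2)\in\mathcal{P}_2^{h,nt}(K_6^3)}\varepsilon^{S^3}(\mathcal{H}_1,\mathcal{H}_2)M_{(\mathcal{H}_1,\mathcal{H}_2)}((v_{i,j,k}))$. *)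

(* Defs.v *)
From HB Require Import structures.
From mathcomp Require Import all_boot all_order all_algebra.
From mathcomp Require classical_sets cardinality.

Set Implicit Arguments.
Unset Strict Implicit.
Unset Printing Implicit Defensive.

Import Order.TTheory GRing.Theory Num.Theory.
Local Open Scope ring_scope.

(** * Tensor powers, spans and quotients *)

Definition update (I : finType) (V : Type) (v : {ffun I -> V}) (i : I) (x : V) :
  {ffun I -> V} := [ffun j => if j == i then x else v j].

Definition multilinear (k : fieldType) (I : finType) (V W : lmodType k)
    (f : {ffun I -> V} -> W) : Prop :=
  forall (i : I) (v : {ffun I -> V}) (a : k) (x y : V),
    f (update v i (a *: x + y)) = a *: f (update v i x) + f (update v i y).

(* [T], with [tens v] in the role of the simple tensor of the family [v], is
   the tensor product of copies of [V] indexed by [I]: [tens] is the universal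
   multilinear map.  See [tensor_power_exists] below. *)
Definition is_tensor_power (k : fieldType) (I : finType) (V T : lmodType k)
    (tens : {ffun I -> V} -> T) : Prop :=
  multilinear tens /\
  forall (W : lmodType k) (f : {ffun I -> V} -> W), multilinear f ->
    exists g : {linear T -> W},
      (forall v, g (tens v) = f v) /\
      (forall h : {linear T -> W}, (forall v, h (tens v) = f v) -> h =1 g).

Lemma update_id (I : finType) (V : Type) (v : {ffun I -> V}) (i : I) :
  update v i (v i) = v.
Proof. by apply/ffunP => j; rewrite ffunE; case: eqP => // ->. Qed.

Lemma multilinear_sum (k : fieldType) (I : finType) (V W : lmodType k)
    (f : {ffun I -> V} -> W) (v : {ffun I -> V}) (i : I) (n : nat)
    (a : 'I_n -> k) (x : 'I_n -> V) : multilinear f ->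
  f (update v i (\sum_j a j *: x j)) = \sum_j a j *: f (update v i (x j)).
Proof.
move=> fL.
have f0 : f (update v i 0) = 0.
  by have := fL i v (-1) 0 0; rewrite scaler0 addr0 scaleN1r addNr.
by elim/big_rec2: _ => // j y z _ <-; rewrite fL.
Qed.

Lemma multilinear_ext (k : fieldType) (I : finType) (V : vectType k) (n : nat)
    (e : n.-tuple V) (W : lmodType k) (f g : {ffun I -> V} -> W) :
  basis_of fullv e -> multilinear f -> multilinear g ->
  (forall c : {ffun I -> 'I_n},
     f [ffun i => tnth e (c i)] = g [ffun i => tnth e (c i)]) ->
  f =1 g.
Proof.
move=> eB fL gL fg v.
have [m] := ubnP #|[set i | v i \notin (e : seq V)]|.
elim: m v => // m IH v; rewrite ltnS => le_m.
have [all_e|] := boolP [forall i, v i \in (e : seq V)].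
  have ex_c i : exists j, v i = tnth e j by apply/tnthP; apply: (forallP all_e).
  have [c vc] := fin_all_exists ex_c.
  have -> : v = [ffun i => tnth e ([ffun i => c i] i)].
    by apply/ffunP => i; rewrite !ffunE.
  exact: fg.
case/forallPn => i vi.
have -> : v = update v i (\sum_j coord e j (v i) *: e`_j).
  by rewrite -(coord_basis eB (memvf _)) update_id.
rewrite !multilinear_sum //; apply: eq_bigr => j _; congr (_ *: _).
apply: IH; apply: leq_trans le_m; apply: proper_card; apply/properP; split.
  apply/subsetP => l; rewrite !inE ffunE; case: eqP => // _.
  by rewrite mem_nth // size_tuple.
by exists i; rewrite !inE // ffunE eqxx mem_nth ?size_tuple.
Qed.

Lemma prod_coord_multilinear (k : fieldType) (I : finType) (V : vectType k)
    (n : nat) (e : n.-tuple V) (c : I -> 'I_n) :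
  multilinear (fun v : {ffun I -> V} => \prod_i coord e (c i) (v i) : k^o).
Proof.
move=> i v a x y.
have prodE z : \prod_j coord e (c j) (update v i z j) =
    coord e (c i) z * \prod_(j | j != i) coord e (c j) (v j).
  rewrite (bigD1 i) //= ffunE eqxx; congr (_ * _).
  by apply: eq_bigr => j /negPf ji; rewrite ffunE ji.
by rewrite !prodE linearP mulrDl -mulrA.
Qed.

Lemma tensor_power_exists (k : fieldType) (I : finType) (V : vectType k) :
  exists (T : lmodType k) (tens : {ffun I -> V} -> T), is_tensor_power tens.
Proof.
pose n := \dim (fullv : {vspace V}).
pose e : n.-tuple V := vbasis fullv.
have eB : basis_of fullv e by apply: vbasisP.
pose T : lmodType k := {ffun {ffun I -> 'I_n} -> k^o}.
pose tens (v : {ffun I -> V}) : T :=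
  [ffun c : {ffun I -> 'I_n} => \prod_i coord e (c i) (v i)].
have tensL : multilinear tens.
  move=> i v a x y; apply/ffunP => c; rewrite !ffunE.
  exact: (prod_coord_multilinear e c).
have tensB (c d : {ffun I -> 'I_n}) :
    tens [ffun i => tnth e (c i)] d = (c == d)%:R.
  rewrite ffunE.
  under eq_bigr => i _ do
    rewrite ffunE (tnth_nth 0) coord_free ?(basis_free eB) //.
  case: eqP => [-> | cd]; first by rewrite big1 // => i _; rewrite eqxx.
  have [i ci] : exists i, c i != d i.
    apply/existsP; rewrite -negb_forall; apply/negP => /forallP cdE.
    by apply: cd; apply/ffunP => i; apply/eqP.
  by rewrite (bigD1 i) //= [_ == _](negPf ci) mul0r.
exists T, tens; split=> // W f fL.
pose g0 (t : T) : W :=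
  \sum_(c : {ffun I -> 'I_n}) t c *: f [ffun i => tnth e (c i)].
have g0L : linear g0.
  move=> a t u; rewrite /g0 scaler_sumr -big_split /=; apply: eq_bigr => c _.
  by rewrite !ffunE scalerDl scalerA.
pose gM := GRing.isLinear.Build k T W *:%R g0 g0L.
pose g : {linear T -> W} := HB.pack g0 gM.
have gE (t : T) : g t = g0 t by [].
have gB (h : {linear T -> W}) : multilinear (fun v => h (tens v)).
  by move=> i v a x y; rewrite tensL linearP.
exists g; split.
  apply: (multilinear_ext eB) => // c; rewrite gE /g0 (bigD1 c) //= tensB eqxx.
  rewrite scale1r big1 ?addr0 // => d dc.
  by rewrite tensB eq_sym (negPf dc) scale0r.
move=> h hE t; rewrite gE /g0.
have {1}-> : t = \sum_(c : {ffun I -> 'I_n}) t c *: tens [ffun i => tnth e (c i)].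
  apply/ffunP => d; rewrite sum_ffunE (bigD1 d) //= !ffunE -[\prod_i _]/_.
  have := tensB d d; rewrite ffunE eqxx => ->; rewrite [_ *: _]mulr1.
  rewrite big1 ?addr0 // => c cd; rewrite ffunE tensB (negPf cd).
  exact: scaler0.
by rewrite linear_sum; apply: eq_bigr => c _; rewrite linearZ hE.
Qed.

Definition in_span (k : fieldType) (T : lmodType k) (S : T -> Prop) (t : T) :
    Prop :=
  exists (n : nat) (c : 'I_n -> k) (s : 'I_n -> T),
    (forall i, S (s i)) /\ t = \sum_(i < n) c i *: s i.

(* [Q] is the quotient of [T] by the subspace [E], with projection [pi]. *)
Definition is_quotient (k : fieldType) (T Q : lmodType k) (E : T -> Prop)
    (pi : {linear T -> Q}) : Prop :=
  (forall q, exists t, pi t = q) /\ (forall t, pi t = 0 <-> E t).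

(** * The complete 3-uniform hypergraph on six vertices *)

(* The vertex i of {1, ..., 6} is the ordinal i - 1. *)
Definition vtx (i : nat) : 'I_6 := inord i.-1.

(* The hyperedge {i, j, k} also stands for the index (i, j, k), i < j < k. *)
Definition hedge : Type := {a : {set 'I_6} | #|a| == 3}.
HB.instance Definition _ := Finite.on hedge.

Lemma card_set3 (T : finType) (x y z : T) :
  uniq [:: x; y; z] -> #|[set x; y; z]| == 3%N.
Proof.
move=> u; rewrite -[3%N]/(size [:: x; y; z]) -(card_uniqP u); apply/eqP.
by apply: eq_card => w; rewrite !inE orbA.
Qed.

Lemma hedge0_subproof : #|[set vtx 1; vtx 2; vtx 3]| == 3.
Proof. by apply: card_set3; rewrite /= !inE -!val_eqE /= !inordK. Qed.

Definition hedge0 : hedge := exist _ [set vtx 1; vtx 2; vtx 3] hedge0_subproof.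

(* The default value [hedge0] is used only if x, y, z are not distinct. *)
Definition edge (x y z : 'I_6) : hedge := insubd hedge0 [set x; y; z].

Lemma val_edge (x y z : 'I_6) :
  uniq [:: x; y; z] -> val (edge x y z) = [set x; y; z].
Proof. by move=> u; rewrite val_insubd card_set3. Qed.

Lemma card_hedge : #|{: hedge}| = 20%N.
Proof.
have <- : 'C(#|{: 'I_6}|, 3) = 20%N by rewrite card_ord.
by rewrite card_sig -card_draws cardsE; apply: eq_card => a; rewrite !inE.
Qed.

Definition tetra (x y z t : 'I_6) : seq hedge :=
  [:: edge x y z; edge x y t; edge x z t; edge y z t].

(** * Homogeneous 2-partitions *)

Definition is_hpart (P : {set hedge} * {set hedge}) : bool :=
  [&& [disjoint P.1 & P.2], P.1 :|: P.2 == [set: hedge],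
      #|P.1| == 10 & #|P.2| == 10].

Definition hpart : Type := {P : {set hedge} * {set hedge} | is_hpart P}.
HB.instance Definition _ := Finite.on hpart.

Definition Pair (P : hpart) (x y z t : 'I_6) : {set hpart} :=
  [set K : hpart | [forall a : hedge, (a \notin tetra x y z t) ==>
     ((a \in (val K).1) == (a \in (val P).1)) &&
     ((a \in (val K).2) == (a \in (val P).2))]].

Definition P1_triples : seq (nat * nat * nat) :=
  [:: (1, 2, 3); (1, 2, 4); (1, 3, 4); (1, 2, 5); (3, 4, 5);
      (1, 5, 6); (2, 4, 6); (2, 5, 6); (3, 4, 6); (4, 5, 6)]%N.

Definition P1_seq : seq hedge :=
  [seq edge (vtx a.1.1) (vtx a.1.2) (vtx a.2) | a <- P1_triples].

Definition P1_left : {set hedge} := [set a in P1_seq].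

Lemma P1_subproof : is_hpart (P1_left, ~: P1_left).
Proof.
have vtxE i j : i \in iota 1 6 -> j \in iota 1 6 ->
    (vtx i == vtx j) = (i == j).
  rewrite !mem_iota -val_eqE => /andP[i1 i6] /andP[j1 j6].
  by rewrite /= !inordK ?prednK // -eqSS !prednK.
pose code (a : hedge) := [seq vtx i \in val a | i <- iota 1 6].
pose codeN (a : nat * nat * nat) :=
  [seq [|| i == a.1.1, i == a.1.2 | i == a.2] | i <- iota 1 6].
pose ok (a : nat * nat * nat) :=
  uniq [:: a.1.1; a.1.2; a.2] && all (mem (iota 1 6)) [:: a.1.1; a.1.2; a.2].
have uP1 : uniq P1_seq.
  apply: (@map_uniq _ _ code); rewrite /P1_seq -map_comp.
  have okP1 : all ok P1_triples by vm_compute.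
  suff /eq_in_map -> : {in P1_triples, code \o (fun a =>
      edge (vtx a.1.1) (vtx a.1.2) (vtx a.2)) =1 codeN} by vm_compute.
  move=> [[i j] l] /(allP okP1)/andP[u /and4P[iI jI lI _]] /=.
  apply/eq_in_map => m mI; rewrite val_edge.
    by rewrite !in_setU !in_set1 !vtxE // orbA.
  by move: u; rewrite /= !in_cons !in_nil !vtxE.
have cardE (s : seq hedge) : uniq s -> #|[set a in s]| = size s.
  by move=> us; rewrite cardsE (card_uniqP us).
have c10 : #|P1_left| = 10%N.
  by rewrite /P1_left (cardE _ uP1) /P1_seq size_map.
rewrite /is_hpart /= -setI_eq0 setICr eqxx setUCr eqxx c10 /=.
by rewrite -(eqn_add2l #|P1_left|) cardsC c10 card_hedge.
Qed.

Definition P1 : hpart := exist _ (P1_left, ~: P1_left) P1_subproof.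

Definition is_epsS3 (eps : {ffun hpart -> int}) : Prop :=
  [/\ forall P, eps P \in [:: -4; -1; 0; 1],
      forall (P : hpart) (x y z t : 'I_6), (x < y)%N -> (y < z)%N -> (z < t)%N ->
        \sum_(K in Pair P x y z t) eps K = 0
    & eps P1 = 1].

(* The map characterized by [is_epsS3] (the default value 0 would be taken only
   if there were no such map). *)
Definition epsS3 : {ffun hpart -> int} :=
  classical_sets.xget [ffun=> 0] is_epsS3.

(** * Nontrivial partitions *)

Definition contains (H : {set hedge}) (s : seq hedge) : bool :=
  all (fun a => a \in H) s.

Definition conf_a (H : {set hedge}) : bool :=
  [exists x, exists y, exists z, exists t, uniq [:: x; y; z; t] &&
    contains H (tetra x y z t)].

Definition conf_b (H : {set hedge}) : bool :=
  [exists x, exists y, exists z, exists t, exists u,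
    uniq [:: x; y; z; t; u] &&
    contains H [:: edge x y z; edge x y t; edge x z t;
                   edge y z u; edge y t u; edge z t u]].

Definition conf_c (H : {set hedge}) : bool :=
  [exists x, exists y, exists z, exists t, exists u, exists v,
    uniq [:: x; y; z; t; u; v] &&
    contains H [:: edge x y u; edge x y v; edge y z u; edge x z u;
                   edge x t v; edge y t v; edge y z t; edge x z t]].

Definition conf_d (H : {set hedge}) : bool :=
  [exists x, exists y, exists z, exists t, exists u, exists v,
    uniq [:: x; y; z; t; u; v] &&
    contains H [:: edge x y z; edge x y t; edge x z t; edge x y u; edge y t u;
                   edge x y v; edge x u v; edge y z v; edge z t v; edge t u v]].

Definition has_conf (H : {set hedge}) : bool :=
  [|| conf_a H, conf_b H, conf_c H | conf_d H].

Definition nontrivial (P : hpart) : bool :=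
  ~~ has_conf (val P).1 && ~~ has_conf (val P).2.

(** * The map det^{S^3} on simple tensors *)

Definition monomial (k : fieldType) (V : vectType k) (e : 2.-tuple V)
    (P : hpart) (v : {ffun hedge -> V}) : k :=
  (\prod_(a in (val P).1) coord e 0 (v a)) *
  (\prod_(a in (val P).2) coord e 1 (v a)).

Definition detS3_form (k : fieldType) (V : vectType k) (e : 2.-tuple V)
    (v : {ffun hedge -> V}) : k :=
  \sum_(P : hpart | nontrivial P) (epsS3 P)%:~R * monomial e P v.

Lemma detS3_form_multilinear (k : fieldType) (V : vectType k)
    (e : 2.-tuple V) : multilinear (detS3_form e : _ -> k^o).
Proof.
move=> i v a x y; rewrite /detS3_form scaler_sumr -big_split /=.
apply: eq_bigr => P _.
have mE w : monomial e P w =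
    \prod_b coord e (if b \in (val P).1 then 0 else 1) (w b).
  rewrite /monomial (bigID (fun b => b \in (val P).1) predT) /=.
  have /and4P[/pred0P dP /eqP uP _ _] := valP P.
  congr (_ * _); first by apply: eq_bigr => b ->.
  have P2 b : (b \in (val P).2) = (b \notin (val P).1).
    have /= := dP b; have := in_setT b; rewrite -uP inE.
    by case: (b \in (val P).1); case: (b \in (val P).2).
  by apply: eq_big => // b; rewrite P2 => /negPf ->.
rewrite !mE (prod_coord_multilinear e _ i v a x y).
by rewrite mulrDr; congr (_ + _); rewrite [LHS]mulrCA.
Qed.

Definition degenerate (V : Type) (v : {ffun hedge -> V}) : Prop :=
  exists x y z t : 'I_6,
    [/\ (x < y)%N, (y < z)%N & (z < t)%N] /\
    [/\ v (edge x y z) = v (edge x y t), v (edge x y t) = v (edge x z t)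
      & v (edge x z t) = v (edge y z t)].

Definition ES3 (k : fieldType) (V T : lmodType k)
    (tens : {ffun hedge -> V} -> T) : T -> Prop :=
  in_span (fun t => exists2 v, degenerate v & t = tens v).

Definition vanishes_on_degenerate (k : fieldType) (V T : lmodType k)
    (tens : {ffun hedge -> V} -> T) (f : T -> k) : Prop :=
  forall v : {ffun hedge -> V}, degenerate v -> f (tens v) = 0.

(* Main.v *)
Require Import Defs.
From HB Require Import structures.
From mathcomp Require Import all_boot all_order all_algebra.
From mathcomp Require Import ring.
From mathcomp Require classical_sets cardinality.

Set Implicit Arguments.
Unset Strict Implicit.
Unset Printing Implicit Defensive.

Import Order.TTheory GRing.Theory Num.Theory.
Local Open Scope ring_scope.

(** Write [c] for a colouring of the 20 triples by {e_1, e_2}. A linear form on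
    the tensor power that kills degenerate tensors is a function of colourings
    such that, for every tetrahedron, the sum over the colourings that agree off
    its four faces and have the same number of e_2's is zero.

    One such function is explicit. For the boundary matrix B of the 2-skeleton
    of the simplex on {1, ..., 5} (rows: triples t, columns: pairs p), the
    10 x 10 determinant of the matrix B(t, p) [v_t, v_(p + 6)], where [u, w] is
    the 2 x 2 bracket, is multilinear in the 20 vectors. It vanishes on
    degenerate families: a tetrahedron containing 6 gives a zero row, and the
    others give rows with vanishing alternating sum.

    For uniqueness, order the colourings lexicographically. Every colouring but
    one ([cmin]) is expressed, through at most three nested relations, by
    smaller colourings and colourings with a monochromatic tetrahedron; a search
    over partial colourings checks this. Hence a solution vanishing at [cmin] is
    zero. Uniqueness makes the determinant invariant under S_6, so its values
    need only be computed for a few hundred colourings. *)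

(** * Numbering of the hyperedges and the tetrahedra *)

(* Colexicographic order: the triples of {0, ..., 4} come first, and the j-th
   pair of {0, ..., 4} together with 5 is the triple number 10 + j. *)
Definition triples : seq (seq nat) :=
  [:: [:: 0; 1; 2]; [:: 0; 1; 3]; [:: 0; 2; 3]; [:: 1; 2; 3]; [:: 0; 1; 4];
      [:: 0; 2; 4]; [:: 1; 2; 4]; [:: 0; 3; 4]; [:: 1; 3; 4]; [:: 2; 3; 4];
      [:: 0; 1; 5]; [:: 0; 2; 5]; [:: 1; 2; 5]; [:: 0; 3; 5]; [:: 1; 3; 5];
      [:: 2; 3; 5]; [:: 0; 4; 5]; [:: 1; 4; 5]; [:: 2; 4; 5]; [:: 3; 4; 5]]%N.

Definition quads : seq (seq nat) :=
  [:: [:: 0; 1; 2; 3]; [:: 0; 1; 2; 4]; [:: 0; 1; 3; 4]; [:: 0; 2; 3; 4];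
      [:: 1; 2; 3; 4]; [:: 0; 1; 2; 5]; [:: 0; 1; 3; 5]; [:: 0; 2; 3; 5];
      [:: 1; 2; 3; 5]; [:: 0; 1; 4; 5]; [:: 0; 2; 4; 5]; [:: 1; 2; 4; 5];
      [:: 0; 3; 4; 5]; [:: 1; 3; 4; 5]; [:: 2; 3; 4; 5]]%N.

Definition triple (i : nat) : seq nat := nth [::] triples i.

Definition hedge_of (i : nat) : hedge :=
  edge (inord (nth 0 (triple i) 0)%N) (inord (nth 0 (triple i) 1)%N)
       (inord (nth 0 (triple i) 2)%N).

Lemma inord6_eq (i j : nat) : (i < 6)%N -> (j < 6)%N ->
  ((inord i : 'I_6) == inord j) = (i == j).
Proof. by move=> i6 j6; rewrite -val_eqE /= !inordK. Qed.

Lemma mem_hedge_of (i k : nat) : (i < 20)%N -> (k < 6)%N ->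
  (inord k \in val (hedge_of i)) = (k \in triple i).
Proof.
move=> i20 k6.
have /allP/(_ _ (mem_nth [::] (i20 : (i < size triples)%N))) :
  all (fun s => [&& size s == 3%N, uniq s & all (gtn 6) s]) triples by [].
rewrite /hedge_of /triple.
case: (nth _ _ _) => [|x [|y [|z [|? ?]]]] // /and3P[_ u].
rewrite [all _ _]/= => /and4P[x6 y6 z6 _].
rewrite val_edge ?inE ?inord6_eq // ?orbA //.
by move: u; rewrite /= !inE !inord6_eq.
Qed.

Lemma hedge_of_inj : {in gtn 20 &, injective hedge_of}.
Proof.
move=> i j i20 j20 eij; rewrite !inE in i20 j20.
have chk : all (fun i => all (fun j =>
    all (fun k => (k \in triple i) == (k \in triple j)) (iota 0 6) ==> (i == j))
  (iota 0 20)) (iota 0 20) by vm_compute.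
apply/eqP; have := allP chk i; rewrite mem_iota => /(_ i20)/allP/(_ j).
rewrite mem_iota => /(_ j20)/implyP; apply; apply/allP => k.
by rewrite mem_iota => k6; rewrite -!mem_hedge_of // eij.
Qed.

Definition hedges : seq hedge := map hedge_of (iota 0 20).

Lemma uniq_hedges : uniq hedges.
Proof.
rewrite map_inj_in_uniq ?iota_uniq // => i j; rewrite !mem_iota => i20 j20.
exact: hedge_of_inj.
Qed.

Lemma mem_hedges (a : hedge) : a \in hedges.
Proof.
have sub : hedges \subset {: hedge} by apply/subsetP.
have eqc : #|hedges| = #|{: hedge}|.
  by rewrite (card_uniqP uniq_hedges) size_map size_iota card_hedge.
by rewrite (subset_cardP eqc sub).
Qed.

Lemma hedge_ofP (a : hedge) : exists2 i, (i < 20)%N & a = hedge_of i.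
Proof.
by have /mapP[i] := mem_hedges a; rewrite mem_iota => i20 ->; exists i.
Qed.

Definition hindex (a : hedge) : nat := index a hedges.

Lemma hindexK (a : hedge) : hedge_of (hindex a) = a.
Proof.
have lt : (index a hedges < 20)%N.
  by rewrite -[20%N](size_map hedge_of (iota 0 20)) index_mem mem_hedges.
by rewrite -[RHS](nth_index a (mem_hedges a)) (nth_map 0%N) ?size_iota // nth_iota.
Qed.

Lemma hindex_lt (a : hedge) : (hindex a < 20)%N.
Proof.
by rewrite -[20%N](size_map hedge_of (iota 0 20)) index_mem mem_hedges.
Qed.

Lemma hedge_ofK (i : nat) : (i < 20)%N -> hindex (hedge_of i) = i.
Proof.
by move=> i20; apply: hedge_of_inj; rewrite ?inE ?hindex_lt // hindexK.
Qed.

Lemma big_hedge (R : Type) (idx : R) (op : Monoid.com_law idx)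
    (P : pred hedge) (f : hedge -> R) :
  \big[op/idx]_(a | P a) f a =
  \big[op/idx]_(i <- iota 0 20 | P (hedge_of i)) f (hedge_of i).
Proof.
rewrite -(big_map hedge_of P) /= -/hedges; apply: perm_big; apply: uniq_perm.
- exact: index_enum_uniq.
- exact: uniq_hedges.
- by move=> a; rewrite mem_index_enum mem_hedges.
Qed.

(** * Colourings and the tetrahedron relations *)

(** [true] stands for $e_2$ and [false] for $e_1$, so [wt] counts the factors equal to $e_2$. *)
Definition colouring := {ffun hedge -> bool}.

Definition wt (c : colouring) : nat := (\sum_a c a)%N.

Definition face (S : {set 'I_6}) (a : hedge) : bool := val a \subset S.

Definition off_eq (S : {set 'I_6}) (c d : colouring) : bool :=
  [forall a, face S a || (d a == c a)].

(** These relations hold for the values on basis tensors of a linear form that kills degenerate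
    tensors ([multilinear_balanced]). In weight ten they are the relations that define [epsS3]
    ([sum_Pair]). *)
Definition balanced (R : zmodType) (F : colouring -> R) : Prop :=
  forall (S : {set 'I_6}) (c : colouring), #|S| = 4%N ->
    \sum_(d | off_eq S c d && (wt d == wt c)) F d = 0.

Definition colour (l : seq bool) : colouring := [ffun a => nth false l (hindex a)].

Definition lst (c : colouring) : seq bool := [seq c (hedge_of i) | i <- iota 0 20].

Lemma size_lst c : size (lst c) = 20%N.
Proof. by rewrite size_map size_iota. Qed.

Lemma nth_lst c i : (i < 20)%N -> nth false (lst c) i = c (hedge_of i).
Proof. by move=> i20; rewrite (nth_map 0%N) ?size_iota // nth_iota. Qed.

Lemma lstK c : colour (lst c) = c.
Proof. by apply/ffunP => a; rewrite ffunE nth_lst ?hindex_lt // hindexK. Qed.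

Lemma colour_hedge_of l i : (i < 20)%N -> colour l (hedge_of i) = nth false l i.
Proof. by move=> i20; rewrite ffunE hedge_ofK. Qed.

Lemma colourK l : size l = 20%N -> lst (colour l) = l.
Proof.
move=> sl; apply: (@eq_from_nth _ false); rewrite size_lst // => i i20.
by rewrite nth_lst // colour_hedge_of.
Qed.

(** * Tetrahedra as lists of hyperedge numbers *)

Definition quad_set (q : seq nat) : {set 'I_6} := [set x in map inord q].

Definition tetra_of (q : seq nat) : seq nat :=
  [seq i <- iota 0 20 | all (mem q) (triple i)].

Definition tetras : seq (seq nat) := Eval vm_compute in map tetra_of quads.

Lemma tetrasE : tetras = map tetra_of quads.
Proof. by vm_compute. Qed.

Lemma quadP q : q \in quads -> [/\ size q = 4%N, uniq q & all (gtn 6) q].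
Proof.
have chk : all (fun q => [&& size q == 4%N, uniq q & all (gtn 6) q]) quads by [].
by move/(allP chk)/and3P => [/eqP].
Qed.

Lemma mem_quad_set q k : q \in quads -> (k < 6)%N ->
  (inord k \in quad_set q) = (k \in q).
Proof.
move=> /quadP[_ _ /allP q6] k6; rewrite inE; apply/mapP/idP => [[j jq e]|kq].
  by have /eqP := e; rewrite inord6_eq ?q6 // => [/eqP->|]; last exact: q6.
by exists k.
Qed.

Lemma card_quad_set q : q \in quads -> #|quad_set q| = 4%N.
Proof.
move=> /quadP[s4 uq /allP q6]; rewrite cardsE; apply: etrans (card_uniqP _) _.
  rewrite map_inj_in_uniq // => i j /q6 i6 /q6 j6 /eqP.
  by rewrite inord6_eq // => /eqP.
by rewrite size_map.
Qed.

Lemma face_quad_set q i : q \in quads -> (i < 20)%N ->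
  face (quad_set q) (hedge_of i) = (i \in tetra_of q).
Proof.
move=> qq i20; rewrite mem_filter mem_iota i20 leq0n !andbT.
have t6 : all (gtn 6) (triple i).
  have chk : all (all (gtn 6)) triples by [].
  by apply: (allP chk); apply: mem_nth.
apply/subsetP/allP => [h k kt|h x].
  have k6 := allP t6 k kt.
  by have := h (inord k); rewrite mem_hedge_of // mem_quad_set // kt => /(_ isT).
rewrite -[x]inord_val mem_hedge_of ?ltn_ord // mem_quad_set ?ltn_ord //.
exact: h.
Qed.

(** * An executable search for reductions *)

Definition restr (c : seq bool) (t : seq nat) : seq bool := map (nth false c) t.

Lemma nth_restr c t i : i \in t -> nth false (restr c t) (index i t) = nth false c i.
Proof. by move=> it; rewrite (nth_map 0%N) ?index_mem // nth_index. Qed.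

Fixpoint put (t : seq nat) (b c : seq bool) : seq bool :=
  match t, b with
  | i :: t', x :: b' => set_nth false (put t' b' c) i x
  | _, _ => c
  end.

Fixpoint bitseqs (n : nat) : seq (seq bool) :=
  if n is n'.+1 then
    [seq false :: b | b <- bitseqs n'] ++ [seq true :: b | b <- bitseqs n']
  else [:: [::]].

Lemma mem_bitseqs (b : seq bool) : b \in bitseqs (size b).
Proof.
elim: b => [|x b IH] //=; rewrite mem_cat.
by case: x; apply/orP; [right | left]; apply: map_f.
Qed.

(** Tabulated once, so that the search only looks up the competing patterns on four faces. *)
Definition swap_table : seq (seq bool * seq (seq bool)) := Eval vm_compute in
  [seq (a, [seq b <- bitseqs 4 | (count id b == count id a) && (b != a)])
  | a <- bitseqs 4].

Fixpoint lookup (a : seq bool) (s : seq (seq bool * seq (seq bool))) :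
    seq (seq bool) :=
  if s is (b, x) :: s' then if a == b then x else lookup a s' else [::].

Lemma mem_lookup a b : size a = 4%N -> size b = 4%N ->
  count id b = count id a -> b != a -> b \in lookup a swap_table.
Proof.
move=> sa sb eab nab; have := mem_bitseqs a; have := mem_bitseqs b.
rewrite sa sb => b4 a4.
have chk : all (fun a => all (fun b => (count id b == count id a) && (b != a) ==>
  (b \in lookup a swap_table)) (bitseqs 4)) (bitseqs 4) by vm_compute.
by have := allP (allP chk a a4) b b4; rewrite eab eqxx nab.
Qed.

(* The colourings other than [c] in the relation of the tetrahedron [t]. *)
Definition others (c : seq bool) (t : seq nat) : seq (seq bool) :=
  [seq put t b c | b <- lookup (restr c t) swap_table].

(** Strict lexicographic order. The answer is [false] once a list ends, so a positive answer on
    prefixes survives every completion. *)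
Fixpoint ltl (a b : seq bool) : bool :=
  match a, b with
  | x :: a', y :: b' =>
      if x then if y then ltl a' b' else false
      else if y then true else ltl a' b'
  | _, _ => false
  end.

(** The lists in [tetras] are increasing, so testing the last index suffices for all four faces to
    be coloured. *)
Definition inside (c : seq bool) (t : seq nat) : bool := (last 0 t < size c)%N.

Fixpoint monochrome (x : bool) (c : seq bool) (t : seq nat) : bool :=
  if t is i :: t' then
    if nth false c i then if x then monochrome x c t' else false
    else if x then false else monochrome x c t'
  else true.

(* Lazy versions of [has] and [all]: [orb] and [andb] are strict under
   [vm_compute]. *)
Fixpoint any (T : Type) (a : T -> bool) (s : seq T) : bool :=
  if s is x :: s' then if a x then true else any a s' else false.

Fixpoint every (T : Type) (a : T -> bool) (s : seq T) : bool :=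
  if s is x :: s' then if a x then every a s' else false else true.

Lemma anyE (T : Type) (a : T -> bool) s : any a s = has a s.
Proof. by elim: s => //= x s ->; case: (a x). Qed.

Lemma everyE (T : Type) (a : T -> bool) s : every a s = all a s.
Proof. by elim: s => //= x s ->; case: (a x). Qed.

Definition mono (c : seq bool) : bool :=
  any (fun t => if inside c t then monochrome (nth false c (head 0%N t)) c t
                else false) tetras.

(* Some relation expresses [c] in terms of colourings that are smaller than
   [c0], contain a monochromatic tetrahedron, or reduce in turn; [c] may be a
   partial colouring, given by its first values. *)
Fixpoint reduces (n : nat) (c0 c : seq bool) : bool :=
  if n is n'.+1 then
    any (fun t => if inside c t then
        every (fun q => if ltl q c0 then true else
                        if mono q then true else reduces n' c0 q) (others c t)
      else false) tetras
  else false.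

(** Only the tetrahedra completed by the newest entry are tried: the earlier ones were tried on
    shorter prefixes. *)
Definition reduces_last (c : seq bool) : bool :=
  any (fun t => if (last 0 t).+1 == size c then
      every (fun q => if ltl q c then true else mono q) (others c t)
    else false)%N tetras.

Arguments reduces : simpl never.
Arguments reduces_last : simpl never.

(** The lexicographically least colouring at which a balanced function can be nonzero: smaller ones
    all reduce, and [eps_det] is 1 here. *)
Definition cmin : seq bool :=
  [:: false; false; false; true; false; false; true; true; false; true;
      true; true; false; false; false; true; true; true; false; true].

(** A prefix that reduces settles all its completions, which prunes the tree of $2^{20}$ colourings.
    Nested relations are tried only on complete colourings, in order of depth. *)
Fixpoint all_reduce (n : nat) (p : seq bool) : bool :=
  if reduces_last p then true else
  if n is n'.+1 then
    if all_reduce n' (rcons p false) then all_reduce n' (rcons p true) else false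
  else
    if p == cmin then true else if reduces 1 p p then true else
    if reduces 2 p p then true else reduces 3 p p.

Lemma all_reduce20 : all_reduce 20 [::].
Proof. by vm_compute. Qed.

(** * Correctness of the search and uniqueness of balanced functions *)

Lemma tetrasP t : t \in tetras ->
  exists2 q, q \in quads & t = tetra_of q.
Proof. by rewrite tetrasE => /mapP. Qed.

Lemma tetra_bounds t : t \in tetras ->
  [/\ size t = 4%N, (last 0 t < 20)%N & forall i, i \in t -> (i <= last 0 t)%N].
Proof.
have chk : all (fun t => [&& size t == 4, last 0 t < 20
  & all (geq (last 0 t)) t])%N tetras by vm_compute.
by move/(allP chk)/and3P => [/eqP ? ? /allP].
Qed.

Lemma size_put t b c : (forall i, i \in t -> (i < size c)%N) ->
  size (put t b c) = size c.
Proof.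
elim: t b => [|i t IH] [|x b] //= lt; rewrite size_set_nth IH.
  by apply/maxn_idPr; apply: lt; rewrite mem_head.
by move=> j jt; apply: lt; rewrite inE jt orbT.
Qed.

Lemma nth_put t b c i : size b = size t ->
  nth false (put t b c) i =
  if i \in t then nth false b (index i t) else nth false c i.
Proof.
elim: t b => [|j t IH] [|x b] //= [sb]; rewrite nth_set_nth /= inE.
by rewrite [j == i]eq_sym; case: eqP => //= _; rewrite IH.
Qed.

Lemma set_nth_cat (T : Type) (x0 x : T) c s i : (i < size c)%N ->
  set_nth x0 (c ++ s) i x = set_nth x0 c i x ++ s.
Proof. by elim: c i => [|y c IH] [|i] //= lt; rewrite IH. Qed.

Lemma put_cat t b c s : (forall i, i \in t -> (i < size c)%N) ->
  put t b (c ++ s) = put t b c ++ s.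
Proof.
elim: t b => [|i t IH] [|x b] //= lt.
have lt' j : j \in t -> (j < size c)%N by move=> jt; apply: lt; rewrite inE jt orbT.
by rewrite IH // set_nth_cat // size_put //; apply: lt; rewrite mem_head.
Qed.

Lemma inside_lt c t : t \in tetras -> inside c t ->
  forall i, i \in t -> (i < size c)%N.
Proof. by move=> /tetra_bounds[_ _ le] lt i /le/leq_ltn_trans; apply. Qed.

Lemma others_cat c s t : t \in tetras -> inside c t ->
  others (c ++ s) t = [seq q ++ s | q <- others c t].
Proof.
move=> tt /(inside_lt tt) lt; rewrite /others -map_comp.
have -> : restr (c ++ s) t = restr c t.
  by apply/eq_in_map => i /lt ic; rewrite nth_cat ic.
by apply: eq_map => b /=; rewrite put_cat.
Qed.

Lemma size_others c t q : t \in tetras -> inside c t -> q \in others c t ->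
  size q = size c.
Proof. by move=> tt /(inside_lt tt) lt /mapP[b _ ->]; rewrite size_put. Qed.

Lemma ltl_cat a b s : ltl a b -> ltl (a ++ s) (b ++ s).
Proof. by elim: a b => [|x a IH] [|y b] //=; case: x y => [] [] //; apply: IH. Qed.

(** The binary value, a measure for induction along [ltl]. *)
Fixpoint num (l : seq bool) : nat :=
  if l is x :: l' then (x * 2 ^ size l' + num l')%N else 0%N.

Lemma num_lt l : (num l < 2 ^ size l)%N.
Proof.
elim: l => //= x l IH; rewrite expnS mul2n -addnn -addnS leq_add //.
by case: x; rewrite ?mul1n ?mul0n.
Qed.

Lemma ltl_num a b : size a = size b -> ltl a b -> (num a < num b)%N.
Proof.
elim: a b => [|x a IH] [|y b] //= [sab]; rewrite sab.
case: x y => [] [] //= lt; rewrite ?mul1n ?mul0n ?add0n.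
- by rewrite ltn_add2l IH.
- by rewrite (leq_trans (num_lt a)) // sab leq_addr.
- exact: IH.
Qed.

Lemma wt_lst c : wt c = (\sum_(i <- iota 0 20) nth false (lst c) i)%N.
Proof.
rewrite /wt big_hedge; apply: eq_big_seq => i; rewrite mem_iota => i20.
by rewrite nth_lst.
Qed.

Section Balanced.

Variables (R : zmodType) (F : colouring -> R).
Hypothesis F_bal : balanced F.

(** The relation of [t] writes [F (colour l)] as minus the sum over the other colourings with the
    same weight and the same values off [t]; all of these occur in [others l t]. *)
Lemma balanced_others l t : t \in tetras -> size l = 20%N ->
  (forall q, q \in others l t -> F (colour q) = 0) -> F (colour l) = 0.
Proof.
move=> tt sl F0; have [q qq tE] := tetrasP tt.
have [s4 t20 tle] := tetra_bounds tt.
have := F_bal (colour l) (card_quad_set qq).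
rewrite (bigD1 (colour l)) /=; last first.
  by rewrite eqxx andbT; apply/forallP => a; rewrite eqxx orbT.
rewrite big1 ?addr0 // => d /andP[/andP[/forallP off /eqP wtd] dc].
have offE i : (i < 20)%N -> i \notin t -> nth false (lst d) i = nth false l i.
  move=> i20; rewrite tE -face_quad_set // => /negPf ni.
  by have := off (hedge_of i); rewrite ni colour_hedge_of // nth_lst // => /eqP.
have lt i : i \in t -> (i < size l)%N by rewrite sl => /tle/leq_ltn_trans; apply.
have dE : lst d = put t (restr (lst d) t) l.
  apply: (@eq_from_nth _ false); rewrite size_lst ?size_put // => i i20.
  rewrite nth_put ?size_map //; case: ifP => [it|/negbT it]; last exact: offE.
  by rewrite nth_restr.
rewrite -[d]lstK; apply: F0; rewrite dE; apply: map_f.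
apply: mem_lookup; rewrite ?size_map //.
  have tfl : t = [seq i <- iota 0 20 | i \in t].
    rewrite {1}tE; apply: eq_in_filter => i ii.
    by rewrite tE mem_filter ii andbT.
  have cE (m : seq bool) : count id (restr m t) =
      (\sum_(i <- iota 0 20 | i \in t) nth false m i)%N.
    rewrite {1}tfl -sum1_count big_map big_filter_cond big_mkcondr.
    by apply: eq_bigr => i _ /=; case: nth.
  (* Off [t] the colourings agree, so equal weights give equal counts on [t]. *)
  move: wtd; rewrite !wt_lst colourK // (bigID (mem t)) [RHS](bigID (mem t)) /=.
  have -> : (\sum_(i <- iota 0 20 | i \notin t) nth false (lst d) i =
             \sum_(i <- iota 0 20 | i \notin t) nth false l i)%N.
    rewrite big_seq_cond [RHS]big_seq_cond; apply: eq_bigr => i /andP[].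
    by rewrite mem_iota => i20 /offE ->.
  by move/addIn; rewrite !cE.
apply: contraNneq dc => e; rewrite -[d]lstK dE e; apply/eqP; congr colour.
apply: (@eq_from_nth _ false); rewrite ?size_put // => i _.
rewrite nth_put ?size_map //; case: ifP => // it.
by rewrite nth_restr.
Qed.

Lemma monochromeE x c t : monochrome x c t -> restr c t = nseq (size t) x.
Proof.
by elim: t => //= i t IH; case: (nth _ _ _) x IH => [] [] //= IH /IH ->.
Qed.

(** A constant pattern has no competitor in [swap_table], so the relation of the monochromatic
    tetrahedron has a single term. *)
Lemma balanced_mono p s : (size p + size s = 20%N)%N -> mono p ->
  F (colour (p ++ s)) = 0.
Proof.
move=> sps; rewrite /mono anyE => /hasP[t tt]; case: ifP => // int mt.
apply: (balanced_others tt); rewrite ?size_cat // => q.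
rewrite others_cat // /others (monochromeE mt).
by have [-> _ _] := tetra_bounds tt; case: (nth _ _ _).
Qed.

(** A reduction found on prefixes is valid for every completion, since recolouring and comparison
    never reach the common suffix [s]. *)
Lemma balanced_reduces n p q s : (size q + size s = 20%N)%N ->
  (forall l, size l = 20%N -> ltl l (p ++ s) -> F (colour l) = 0) ->
  reduces n p q -> F (colour (q ++ s)) = 0.
Proof.
move=> sqs small; elim: n q sqs => // n IH q sqs.
rewrite -[reduces _ _ _]/(any _ _) anyE => /hasP[t tt].
case: ifP => // int; rewrite everyE => /allP red.
apply: (balanced_others tt); rewrite ?size_cat // => x.
rewrite others_cat // => /mapP[y yo ->].
have sy := size_others tt int yo.
have := red y yo; case: ifP => [lt _|_].
  by apply: small; rewrite ?size_cat ?sy // ltl_cat.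
by case: ifP => [my _|_]; [apply: balanced_mono | apply: IH]; rewrite ?sy.
Qed.

Lemma reduces_lastW p : reduces_last p -> reduces 1 p p.
Proof.
rewrite -[reduces _ _ _]/(any _ _) /reduces_last !anyE => /hasP[t tt tr].
apply/hasP; exists t => //.
case: eqP tr => // e; rewrite /inside e leqnn !everyE => /allP h; apply/allP => q.
by move/h; case: ifP => // _ ->.
Qed.

(** Follows the branch of the search that leads to [p ++ s], down to the prefix where it stopped. *)
Lemma all_reduceP n p s : all_reduce n p -> size s = n -> p ++ s != cmin ->
  exists m p' s', p ++ s = p' ++ s' /\ reduces m p' p'.
Proof.
elim: n p s => [|n IH] p s /=.
  case: ifP => [/reduces_lastW r _ _ _|_]; first by exists 1%N, p, s.
  case: s => // + _; rewrite cats0; case: eqP => // _.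
  case: ifP => [r _ _|_]; first by exists 1%N, p, [::]; rewrite cats0.
  case: ifP => [r _ _|_ r _]; first by exists 2%N, p, [::]; rewrite cats0.
  by exists 3%N, p, [::]; rewrite cats0.
case: ifP => [/reduces_lastW r _ _ _|_]; first by exists 1%N, p, s.
case: ifP => // r0 r1; case: s => // x s [sn]; rewrite -cat_rcons.
by apply: IH => //; case: x.
Qed.

Theorem balanced_eq0 : F (colour cmin) = 0 -> forall c, F c = 0.
Proof.
move=> Fmin c; rewrite -[c]lstK; have := size_lst c; move: (lst c) => l.
have [n] := ubnP (num l); elim: n l => // n IH l le_n sl.
have [->//|ne] := eqVneq l cmin.
have [m [p [s [lE r]]]] := all_reduceP all_reduce20 sl ne.
rewrite [l]lE; apply: balanced_reduces r; rewrite -?size_cat -lE // => l' sl' lt.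
by apply: IH => //; apply: leq_trans (ltl_num _ lt) le_n; rewrite sl'.
Qed.

End Balanced.

(** * Faces of tetrahedra and degenerate families *)

Lemma hedge_sub_eq (a b : hedge) : val b \subset val a -> a = b.
Proof.
move=> ba; apply: val_inj; apply/eqP.
by rewrite eq_sym eqEcard ba (eqP (valP a)) (eqP (valP b)).
Qed.

Lemma card_set4 (x y z t : 'I_6) : uniq [:: x; y; z; t] ->
  #|[set x; y; z; t]| = 4%N.
Proof.
by move=> u; apply: etrans (card_uniqP u); apply: eq_card => b; rewrite !inE !orbA.
Qed.

Lemma mem_tetra (x y z t : 'I_6) (a : hedge) : uniq [:: x; y; z; t] ->
  (a \in tetra x y z t) = face [set x; y; z; t] a.
Proof.
move=> u.
have /and3P[nxy nxz nxt] : [&& x != y, x != z & x != t].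
  by move: u; rewrite /= !inE !negb_or => /andP[].
have /and3P[nyz nyt nzt] : [&& y != z, y != t & z != t].
  by move: u; rewrite /= !inE !negb_or => /and4P[_ /andP[-> ->] ->].
have v1 : val (edge x y z) = [set x; y; z].
  by rewrite val_edge //= !inE !negb_or nxy nxz nyz.
have v2 : val (edge x y t) = [set x; y; t].
  by rewrite val_edge //= !inE !negb_or nxy nxt nyt.
have v3 : val (edge x z t) = [set x; z; t].
  by rewrite val_edge //= !inE !negb_or nxz nxt nzt.
have v4 : val (edge y z t) = [set y; z; t].
  by rewrite val_edge //= !inE !negb_or nyz nyt nzt.
apply/idP/idP => [|fa].
  rewrite !inE => /or4P[] /eqP->; rewrite /face ?v1 ?v2 ?v3 ?v4;
  by apply/subsetP => b; rewrite !inE => /orP[/orP[]|] /eqP->; rewrite !eqxx ?orbT.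
(* A hyperedge inside the tetrahedron is determined by the one vertex [w] that it misses. *)
have /cards1P[w wE] : #|[set x; y; z; t] :\: val a| == 1%N.
  by rewrite cardsD (setIidPr fa) card_set4 // (eqP (valP a)).
have aE : val a = [set x; y; z; t] :\ w.
  by rewrite -wE setDDr setDv set0U (setIidPr fa).
have : w \in [set x; y; z; t] :\: val a by rewrite wE set11.
have neqE := (nxy, nxz, nxt, nyz, nyt, nzt, eq_sym y x, eq_sym z x, eq_sym t x,
  eq_sym z y, eq_sym t y, eq_sym t z).
rewrite !inE => /andP[_ /orP[/orP[/orP[]|]|] /eqP wx]; subst w;
  [rewrite (@hedge_sub_eq a (edge y z t)) | rewrite (@hedge_sub_eq a (edge x z t))
  |rewrite (@hedge_sub_eq a (edge x y t)) | rewrite (@hedge_sub_eq a (edge x y z))];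
  rewrite ?eqxx ?orbT // aE ?v1 ?v2 ?v3 ?v4 !subUset !sub1set !inE !eqxx ?orbT;
  by rewrite !neqE.
Qed.

Lemma set4P (S : {set 'I_6}) : #|S| = 4%N ->
  exists x y z t : 'I_6, [/\ (x < y)%N, (y < z)%N & (z < t)%N] /\
    S = [set x; y; z; t].
Proof.
move=> cS; have : sorted (relpre val ltn) (enum S).
  rewrite /enum_mem -enumT; apply: sorted_filter => [i j l|]; first exact: ltn_trans.
  by rewrite -sorted_map val_enum_ord iota_ltn_sorted.
have : S = [set i in enum S] by apply/setP => i; rewrite inE mem_enum.
move: cS; rewrite cardE.
case: (enum S) => [|x [|y [|z [|t [|//]]]]] //= _ SE /and4P[xy yz zt _].
exists x, y, z, t; split=> //.
by rewrite SE; apply/setP => i; rewrite !inE !orbA.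
Qed.

Lemma lt4_uniq (x y z t : 'I_6) : (x < y)%N -> (y < z)%N -> (z < t)%N ->
  uniq [:: x; y; z; t].
Proof.
move=> xy yz zt; rewrite -(map_inj_uniq val_inj) /= !inE !negb_or.
rewrite !neq_ltn xy yz zt (ltn_trans xy yz) (ltn_trans yz zt).
by rewrite (ltn_trans xy (ltn_trans yz zt)).
Qed.

Lemma quad_of_set4 (x y z t : 'I_6) : (x < y)%N -> (y < z)%N -> (z < t)%N ->
  exists2 q, q \in quads & quad_set q = [set x; y; z; t].
Proof.
move=> xy yz zt.
have chk : all (fun x => all (fun y => all (fun z => all (fun t =>
    [&& x < y, y < z & z < t] ==> ([:: x; y; z; t] \in quads))
  (iota 0 6)) (iota 0 6)) (iota 0 6))%N (iota 0 6) by vm_compute.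
exists [:: val x; val y; val z; val t].
  have m6 (i : 'I_6) : val i \in iota 0 6 by rewrite mem_iota /= ltn_ord.
  have := allP (allP (allP (allP chk _ (m6 x)) _ (m6 y)) _ (m6 z)) _ (m6 t).
  by rewrite /= xy yz zt.
by apply/setP => i; rewrite !inE !inord_val !orbA.
Qed.

(** Frees degeneracy from the ordering of the vertices. *)
Lemma degenerate_faceP (V : Type) (v : {ffun hedge -> V}) :
  degenerate v <-> exists (S : {set 'I_6}) (u : V),
    #|S| = 4%N /\ forall a, face S a -> v a = u.
Proof.
split=> [[x [y [z [t [[xy yz zt] [e1 e2 e3]]]]]]|[S [u [cS vS]]]].
  have u4 := lt4_uniq xy yz zt.
  exists [set x; y; z; t], (v (edge x y z)); split; first exact: card_set4.
  move=> a; rewrite -mem_tetra // !inE.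
  by case/or4P=> /eqP-> //; rewrite e1 ?e2 ?e3.
have [x [y [z [t [[xy yz zt] SE]]]]] := set4P cS.
exists x, y, z, t; split=> //; have u4 := lt4_uniq xy yz zt.
have fE a : a \in tetra x y z t -> v a = u by rewrite mem_tetra // -SE => /vS.
by split; rewrite !fE ?inE ?eqxx ?orbT.
Qed.

(** * The bracket determinant *)

Lemma hedge_of_eq i j : (i < 20)%N -> (j < 20)%N ->
  (hedge_of i == hedge_of j) = (i == j).
Proof. by move=> i20 j20; apply/eqP/eqP => [/hedge_of_inj->|->]. Qed.

(* The coefficient of the j-th pair of {0, ..., 4} in the simplicial boundary
   of the i-th triple of {0, ..., 4}. *)
Definition boundary (i j : nat) : int :=
  let t := triple i in let p := take 2 (triple (10 + j)) in
  if p == behead t then 1 else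
  if p == [:: nth 0 t 0; nth 0 t 2]%N then -1 else
  if p == take 2 t then 1 else 0.

Definition colour_ord (b : bool) : 'I_2 := if b then 1 else 0.

Lemma colour_ord_eq (b c : bool) : (colour_ord b == colour_ord c) = (b == c).
Proof. by case: b; case: c. Qed.

Section BracketDet.

Variables (k : fieldType) (V : vectType k) (e : 2.-tuple V).

Definition bracket (x y : V) : k :=
  coord e 0 x * coord e 1 y - coord e 1 x * coord e 0 y.

Definition bracket_mx (v : {ffun hedge -> V}) : 'M[k]_10 :=
  \matrix_(i, j) ((boundary i j)%:~R *
                  bracket (v (hedge_of i)) (v (hedge_of (10 + j)))).

Definition bracket_det (v : {ffun hedge -> V}) : k := \det (bracket_mx v).

(** The bracket is bilinear, and each vector enters exactly one row (hyperedges without the vertex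
    5) or exactly one column (hyperedges with it). *)
Lemma bracket_det_multilinear : multilinear (bracket_det : _ -> k^o).
Proof.
move=> a v r x y; have [n n20 ->] := hedge_ofP a.
pose w := update v (hedge_of n).
have wE u m : (m < 20)%N -> w u (hedge_of m) = if m == n then u else v (hedge_of m).
  by move=> m20; rewrite ffunE hedge_of_eq.
have lt1 (i : 'I_10) : (i < 20)%N by apply: leq_trans (ltn_ord i) _.
have lt2 (i : 'I_10) : (10 + i < 20)%N by rewrite -[20%N]/(10 + 10)%N ltn_add2l.
have liftF (i : 'I_10) j : (lift i j == i) = false.
  by rewrite eq_sym (negPf (neq_lift _ _)).
rewrite -/(w _) -/(w x) -/(w y).
have -> : r *: (bracket_det (w x) : k^o) + bracket_det (w y) =
    r * bracket_det (w x) + 1 * bracket_det (w y).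
  by rewrite mul1r.
have [n10|n10] := ltnP n 10.
  have neq (j : 'I_10) : (10 + j == n)%N = false.
    by apply/negbTE; rewrite gtn_eqF // ltn_addr.
  apply: (determinant_multilinear (i0 := Ordinal n10)).
  - apply/rowP => j; rewrite !mxE !wE // eqxx neq /bracket !linearP /=.
    by rewrite mul1r; ring.
  - apply/matrixP => i j; rewrite !mxE !wE // neq.
    by rewrite -[val (lift _ _) == n]/(lift (Ordinal n10) i == Ordinal n10) liftF.
  - apply/matrixP => i j; rewrite !mxE !wE // neq.
    by rewrite -[val (lift _ _) == n]/(lift (Ordinal n10) i == Ordinal n10) liftF.
have m10 : (n - 10 < 10)%N by rewrite ltn_subLR.
have neq (j : 'I_10) : (val j == n)%N = false.
  by apply/negbTE; rewrite ltn_eqF // (leq_trans (ltn_ord j)).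
have nE : n = (10 + Ordinal m10)%N by rewrite /= subnKC.
rewrite /bracket_det -![\det (bracket_mx _)]det_tr.
apply: (determinant_multilinear (i0 := Ordinal m10)).
- apply/rowP => j; rewrite !mxE !wE // neq -nE eqxx /bracket !linearP /=.
  by rewrite mul1r; ring.
- apply/matrixP => i j; rewrite !mxE !wE // neq [in X in _ == X]nE eqn_add2l.
  by rewrite -[val (lift _ _) == _]/(lift (Ordinal m10) i == Ordinal m10) liftF.
- apply/matrixP => i j; rewrite !mxE !wE // neq [in X in _ == X]nE eqn_add2l.
  by rewrite -[val (lift _ _) == _]/(lift (Ordinal m10) i == Ordinal m10) liftF.
Qed.
Lemma bracket_self x : bracket x x = 0.
Proof. by rewrite /bracket mulrC subrr. Qed.

(* Either the tetrahedron contains the vertex 5, and its other face gives a zero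
   row, or the alternating sum of the rows of its faces vanishes. *)
Lemma bracket_det_degenerate v : degenerate v -> bracket_det v = 0.
Proof.
case/degenerate_faceP => S [u [cS vS]].
have [x [y [z [t [[xy yz zt] SE]]]]] := set4P cS.
have [q qq qE] := quad_of_set4 xy yz zt.
have {vS}vq n : (n < 20)%N -> n \in tetra_of q -> v (hedge_of n) = u.
  by move=> n20; rewrite -face_quad_set // qE -SE => /vS.
have lt2 j : (j < 10)%N -> (10 + j < 20)%N.
  by rewrite -[20%N]/(10 + 10)%N ltn_add2l.
have jI (j : 'I_10) : (j : nat) \in iota 0 10 by rewrite mem_iota ltn_ord.
have chk : all (fun q => let t := tetra_of q in
    has (fun i => (i \in t) && all (fun j => (boundary i j == 0) || (10 + j \in t)%N)
      (iota 0 10)) (iota 0 10) ||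
    [&& all (gtn 10) t, size t == 4%N, uniq t & all (fun j => boundary (nth 0 t 0)%N j -
      boundary (nth 0 t 1)%N j + boundary (nth 0 t 2)%N j - boundary (nth 0 t 3)%N j == 0)
      (iota 0 10)]) quads by vm_compute.
have := allP chk q qq; cbv beta zeta => /orP[/hasP[i]|].
  rewrite mem_iota => /andP[_ i10] /andP[it /allP ib].
  apply/eqP/det0P; exists (delta_mx 0 (Ordinal i10)).
    by apply/eqP => /matrixP/(_ 0 (Ordinal i10))/eqP; rewrite !mxE !eqxx oner_eq0.
  rewrite -rowE; apply/rowP => j; rewrite !mxE.
  have /orP[/eqP->|jt] := ib _ (jI j); first by rewrite mul0r.
  by rewrite !vq ?lt2 ?bracket_self ?mulr0 // (leq_trans i10).
case/and4P; case: (tetra_of q) vq => [|i0 [|i1 [|i2 [|i3 [|? ?]]]]] // vq.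
rewrite [all _ _]/= => /and5P[l0 l1 l2 l3 _] _ ui /allP ib.
pose del i (l : (i < 10)%N) : 'rV[k]_10 := delta_mx 0 (Ordinal l).
apply/eqP/det0P; exists (del i0 l0 - del i1 l1 + del i2 l2 - del i3 l3).
  apply/eqP => /matrixP/(_ 0 (Ordinal l0))/eqP; rewrite !mxE !eqxx.
  have /and3P[n1 n2 n3] : [&& i0 != i1, i0 != i2 & i0 != i3].
    by move: ui; rewrite /= !inE !negb_or => /andP[].
  rewrite -![Ordinal _ == Ordinal _]val_eqE /= (negPf n1) (negPf n2) (negPf n3).
  by rewrite !subr0 addr0 oner_eq0.
rewrite !(mulmxDl, mulNmx) -!rowE; apply/rowP => j; rewrite !mxE /=.
have lt i : (i < 10)%N -> (i < 20)%N by move/leq_trans; apply.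
rewrite (vq i0) ?(vq i1) ?(vq i2) ?(vq i3) ?lt ?inE ?eqxx ?orbT //.
rewrite -!mulrBl -mulrDl -mulrBl.
rewrite -!intrB -intrD -intrB.
by have /= /eqP -> := ib _ (jI j); rewrite mul0r.
Qed.

Hypothesis e_basis : basis_of fullv e.

Definition basis_vec (b : bool) : V := e`_(colour_ord b).

Lemma coord_basis_vec (b c : bool) :
  coord e (colour_ord b) (basis_vec c) = (c == b)%:R.
Proof. by rewrite coord_free ?(basis_free e_basis) // colour_ord_eq. Qed.

Definition basis_fun (c : colouring) : {ffun hedge -> V} :=
  [ffun a => basis_vec (c a)].

Lemma basis_funE c a : basis_fun c a = basis_vec (c a).
Proof. by rewrite ffunE. Qed.

End BracketDet.

(** * Expansion over basis colourings *)

(** With colours read as 0 and 1, the bracket of two basis vectors is the difference of their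
    colours. This is thus the bracket determinant at a basis family, taken over the integers to
    serve all fields and to be computable. *)
Definition eps_det (c : colouring) : int :=
  \det (\matrix_(i < 10, j < 10)
          (boundary i j * ((c (hedge_of (10 + j)))%:R - (c (hedge_of i))%:R))).

Section Expand.

Variables (k : fieldType) (V : vectType k) (e : 2.-tuple V).
Hypothesis e_basis : basis_of fullv e.

Lemma bracket_det_basis_fun c : bracket_det e (basis_fun e c) = (eps_det c)%:~R.
Proof.
rewrite /bracket_det /eps_det -(det_map_mx intr); congr (\det _).
apply/matrixP => i j; rewrite !mxE rmorphM rmorphB /= /bracket.
rewrite -[0 : 'I_2]/(colour_ord false) -[1 : 'I_2]/(colour_ord true).
rewrite !basis_funE !coord_basis_vec // !rmorph_nat.
by case: (c (hedge_of i)); case: (c (hedge_of (10 + j)));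
  rewrite /= ?(mulr0, mul0r, mulr1, subr0, sub0r, subrr) ?oppr0 ?mulr0.
Qed.

(** Both sides are multilinear, and on a basis family only one product survives. *)
Lemma multilinear_basis_sum (phi : {ffun hedge -> V} -> k^o) : multilinear phi ->
  forall v, phi v = \sum_(d : colouring)
    (\prod_a coord e (colour_ord (d a)) (v a)) * phi (basis_fun e d).
Proof.
move=> phiL; apply: (multilinear_ext e_basis) => //.
  move=> i v a x y; rewrite scaler_sumr -big_split /=; apply: eq_bigr => d _.
  rewrite (prod_coord_multilinear e (fun a => colour_ord (d a)) i v a x y).
  by rewrite mulrDl -mulrA.
move=> c; pose d0 : colouring := [ffun a => c a == 1].
have -> : [ffun a => tnth e (c a)] = basis_fun e d0.
  apply/ffunP => a; rewrite !ffunE (tnth_nth 0); congr (_`_ _).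
  by case: (c a) => [[|[|]]] //= i2; rewrite -val_eqE.
rewrite (bigD1 d0) //= big1 => [|a _]; last first.
  by rewrite basis_funE coord_basis_vec // eqxx.
rewrite mul1r big1 ?addr0 // => d dd0.
have [a da] : exists a, d a != d0 a.
  by apply/existsP; apply: contraNT dd0; rewrite negb_exists => /forallP dE;
    apply/eqP/ffunP => a; apply/eqP; have := dE a; rewrite negbK.
rewrite (bigD1 a) //= basis_funE coord_basis_vec // eq_sym (negPf da).
by rewrite !mul0r.
Qed.

(* Evaluating at [e_1 + b e_2] on the faces of [S] and at [b^(c a) e_(c a)]
   elsewhere turns [phi] into a polynomial in [b] whose coefficients are the
   sums in [balanced]. *)
Lemma multilinear_balanced (phi : {ffun hedge -> V} -> k^o) :
  (forall n, exists s : seq k, uniq s /\ size s = n) ->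
  multilinear phi -> (forall v, degenerate v -> phi v = 0) ->
  balanced (fun c => phi (basis_fun e c)).
Proof.
move=> k_inf phiL phi0 S c cS.
pose p : {poly k} := \sum_(d | off_eq S c d) phi (basis_fun e d) *: 'X^(wt d).
have p0 : p = 0.
  (* Every scalar is a root, and the field has more elements than the degree of [p] allows. *)
  have [s [us ss]] := k_inf (size p).+1.
  apply: (@roots_geq_poly_eq0 _ p s) => //; last by rewrite ss.
  apply/allP => b _; rewrite rootE /p horner_sum.
  pose v : {ffun hedge -> V} := [ffun a =>
    if face S a then basis_vec e false + b *: basis_vec e true
    else b ^+ c a *: basis_vec e (c a)].
  have pv0 : phi v = 0.
    apply: phi0; apply/degenerate_faceP.
    exists S, (basis_vec e false + b *: basis_vec e true); split=> // a.
    by rewrite ffunE => ->.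
  apply/eqP; rewrite -[RHS]pv0 (multilinear_basis_sum phiL v).
  rewrite [RHS](bigID (off_eq S c)) /=.
  rewrite [X in _ = _ + X]big1 ?addr0 => [|d].
    apply: eq_bigr => d /forallP dc.
    rewrite hornerZ hornerXn mulrC; congr (_ * _); rewrite /wt expr_sum.
    apply: eq_bigr => a _; rewrite ffunE; have := dc a.
    case: ifP => [_ _|_ /eqP dca].
      rewrite linearD linearZ /= !coord_basis_vec //.
      by case: (d a); rewrite ?(mulr0, mulr1, add0r, addr0).
    by rewrite linearZ /= coord_basis_vec // dca eqxx mulr1.
  rewrite negb_forall => /existsP[a]; rewrite negb_or => /andP[na dca].
  rewrite (bigD1 a) //= ffunE (negPf na) linearZ /=.
  rewrite coord_basis_vec // eq_sym (negPf dca).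
  by rewrite mulr0 !mul0r.
have /(congr1 (fun q : {poly k} => q`_(wt c))) := p0.
rewrite coef0 /p coef_sum => coef_c; rewrite -[RHS]coef_c.
rewrite big_mkcondr; apply: eq_bigr => d _.
by rewrite coefZ coefXn eq_sym; case: eqP => _; rewrite ?mulr1 ?mulr0.
Qed.

End Expand.

Lemma rat_seq n : exists s : seq rat, uniq s /\ size s = n.
Proof.
exists [seq i%:R | i <- iota 0 n]; rewrite size_map size_iota; split=> //.
by rewrite map_inj_uniq ?iota_uniq // => i j /eqP; rewrite eqr_nat => /eqP.
Qed.

(** Proved over the rationals, an infinite field in which the integers embed. *)
Lemma eps_det_balanced : balanced eps_det.
Proof.
pose V : vectType rat := 'rV[rat]_2.
have eB : basis_of fullv (vbasis (fullv : {vspace V})) by apply: vbasisP.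
have d2 : \dim (fullv : {vspace V}) = 2 by rewrite dimvf.
pose e : 2.-tuple V := tcast d2 (vbasis fullv).
have {}eB : basis_of fullv e by rewrite val_tcast.
move=> S c cS; apply/eqP; rewrite -(intr_eq0 rat) rmorph_sum /=; apply/eqP.
rewrite -[RHS](multilinear_balanced eB rat_seq (bracket_det_multilinear e)
  (fun v => @bracket_det_degenerate _ _ e v) c cS).
by apply: eq_bigr => d _; rewrite bracket_det_basis_fun.
Qed.

Lemma wt_colour l : size l = 20%N -> wt (colour l) = count id l.
Proof.
move=> sl; have -> : count id l = (\sum_(b <- l) b)%N.
  by elim: (l) => [|b m IH]; rewrite ?big_nil // big_cons -IH.
by rewrite wt_lst colourK // (big_nth false) sl.
Qed.

Lemma wt_split c : wt c =
  (\sum_(i < 10) c (hedge_of i) + \sum_(j < 10) c (hedge_of (10 + j)))%N.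
Proof.
rewrite /wt big_hedge -[iota 0 20]/(iota 0 10 ++ [seq (10 + j)%N | j <- iota 0 10]).
rewrite big_cat big_map -[iota 0 10]/(index_iota 0 10).
by congr addn; rewrite big_mkord.
Qed.

(* Scaling by 2 the rows of one colour or the columns of the other gives the
   same matrix. *)
Lemma eps_det_wt c : eps_det c != 0 -> wt c = 10%N.
Proof.
move=> nz; pose M := \matrix_(i < 10, j < 10)
  (boundary i j * ((c (hedge_of (10 + j)))%:R - (c (hedge_of i))%:R)).
pose dr : 'rV[int]_10 := \row_i 2 ^+ c (hedge_of i).
pose dc : 'rV[int]_10 := \row_j 2 ^+ ~~ c (hedge_of (10 + j)).
have : \det (diag_mx dr *m M) = \det (M *m diag_mx dc).
  congr (\det _); apply/matrixP => i j; rewrite mul_diag_mx mul_mx_diag !mxE.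
  case: (c (hedge_of i)); case: (c (hedge_of (10 + j))) => /=;
  by rewrite ?(subrr, mulr0, mul0r) // mulrC.
rewrite !det_mulmx !det_diag mulrC => /(mulfI nz).
have -> : \prod_i dr 0 i = 2 ^+ (\sum_(i < 10) c (hedge_of i))%N.
  by rewrite expr_sum; apply: eq_bigr => i _; rewrite mxE.
have -> : \prod_i dc 0 i = 2 ^+ (\sum_(i < 10) ~~ c (hedge_of (10 + i)))%N.
  by rewrite expr_sum; apply: eq_bigr => i _; rewrite mxE.
(* Equal powers of 2: as many rows are coloured [true] as columns are coloured [false]. *)
move/ieexprIn => e; rewrite wt_split e // -big_split /=.
rewrite -[RHS](card_ord 10) -sum1_card; apply: eq_bigr => i _.
by case: (c _).
Qed.

(** * Computing the determinant *)

Definition rem_nth (T : Type) (j : nat) (s : seq T) : seq T :=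
  take j s ++ drop j.+1 s.

Lemma nth_rem_nth (T : Type) (x0 : T) j s i : (j < size s)%N ->
  nth x0 (rem_nth j s) i = nth x0 s (bump j i).
Proof.
move=> js; rewrite nth_cat size_take js /bump; case: (leqP j i) => ij.
  by rewrite nth_drop addSn subnKC.
by rewrite nth_take.
Qed.

Lemma size_rem_nth (T : Type) j (s : seq T) : (j < size s)%N ->
  size (rem_nth j s) = (size s).-1.
Proof.
move=> js; rewrite size_cat size_take js size_drop subnS -!subn1.
by rewrite addnBA ?subn_gt0 // subnKC // ltnW.
Qed.

(** Laplace expansion along the first row, executable on lists. Skipping zero entries makes it cheap
    on these sparse matrices. *)
Fixpoint det_list (n : nat) (A : seq (seq int)) : int :=
  if n is n'.+1 then
    foldr (fun j acc =>
      let a := nth 0 (head [::] A) j in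
      if a == 0 then acc else
      (if odd j then - a else a) * det_list n' (map (rem_nth j) (behead A)) + acc)
    0 (iota 0 n)
  else 1.

Lemma det_listE n A : size A = n -> all (fun r => size r == n) A ->
  det_list n A = \det (\matrix_(i < n, j < n) nth 0 (nth [::] A i) j).
Proof.
elim: n A => [|n IH] A sA rA; first by rewrite det_mx00.
case: A sA rA => // r A [sA] /andP[/eqP sr /allP rA].
rewrite (expand_det_row _ ord0).
pose D j := det_list n (map (rem_nth j) A).
have -> : det_list n.+1 (r :: A) =
    \sum_(j < n.+1) nth 0 r j * ((-1) ^+ j * D j).
  rewrite -(big_mkord xpredT (fun j => nth 0 r j * ((-1) ^+ j * D j))).
  rewrite /index_iota subn0 /det_list -/det_list.
  elim: (iota 0 n.+1) => [|j s IHs] /=; first by rewrite big_nil.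
  rewrite big_cons IHs; case: eqP => [->|_]; first by rewrite mul0r add0r.
  congr (_ + _); rewrite -signr_odd /D; case: odd; rewrite ?expr0 ?expr1; ring.
apply: eq_bigr => j _; rewrite mxE /cofactor add0n; congr (_ * (_ * _)).
rewrite /D IH ?size_map //; last first.
  apply/allP => _ /mapP[r' /rA/eqP sr' ->]; by rewrite size_rem_nth sr' ?ltn_ord.
congr (\det _); apply/matrixP => i k; rewrite !mxE.
rewrite (nth_map [::]) ?sA // nth_rem_nth // (eqP (rA _ _)) ?mem_nth ?sA //.
Qed.

Definition boundary_table : seq (seq int) := Eval vm_compute in
  [seq [seq boundary i j | j <- iota 0 10] | i <- iota 0 10].

Definition eps_rows (l : seq bool) : seq (seq int) :=
  [seq (let x := nth false l i in let b := nth [::] boundary_table i in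
    [seq (if nth false l (10 + j) then if x then 0 else nth 0 b j
          else if x then - nth 0 b j else 0)
    | j <- iota 0 10]) | i <- iota 0 10].

Definition eps_list (l : seq bool) : int := det_list 10 (eps_rows l).

Lemma eps_listE l : size l = 20%N -> eps_det (colour l) = eps_list l.
Proof.
move=> sl; rewrite /eps_list det_listE //.
congr (\det _); apply/matrixP => i j; rewrite !mxE.
rewrite (nth_map 0%N) ?size_iota // (nth_map 0%N) ?size_iota // !nth_iota // !add0n.
have lt2 : (10 + j < 20)%N by rewrite -[20%N]/(10 + 10)%N ltn_add2l.
have lt1 : (i < 20)%N by apply: leq_trans (ltn_ord i) _.
rewrite !colour_hedge_of //.
have -> : nth 0 (nth [::] boundary_table i) j = boundary i j.
  have -> : boundary_table = [seq [seq boundary i j | j <- iota 0 10] | i <- iota 0 10].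
    by vm_compute.
  by rewrite (nth_map 0%N) ?size_iota // (nth_map 0%N) ?size_iota // !nth_iota.
by case: (nth false l i); case: (nth false l _);
  rewrite /= ?(subrr, mulr0, subr0, sub0r, mulr1, mulrN1).
Qed.

(** * Invariance under relabelling of the vertices *)

Section Symmetry.

Variables (s : 'I_6 -> 'I_6) (sK : involutive s).

(** Preimage and image agree because [s] is an involution; the default [hedge0] is never reached. *)
Definition hedge_act (a : hedge) : hedge := insubd hedge0 (s @^-1: val a).

Lemma val_hedge_act a : val (hedge_act a) = s @^-1: val a.
Proof. by rewrite val_insubd card_preimset ?(valP a) //; apply: inv_inj. Qed.

Lemma hedge_actK : involutive hedge_act.
Proof.
move=> a; apply: val_inj; apply/setP => x.
by rewrite !val_hedge_act !inE sK.
Qed.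

Definition colour_act (c : colouring) : colouring := [ffun a => c (hedge_act a)].

Lemma colour_actK : involutive colour_act.
Proof. by move=> c; apply/ffunP => a; rewrite !ffunE hedge_actK. Qed.

Lemma wt_colour_act c : wt (colour_act c) = wt c.
Proof.
rewrite /wt [RHS](reindex_inj (inv_inj hedge_actK)).
by apply: eq_bigr => a _; rewrite ffunE.
Qed.

Lemma off_eq_act S c d :
  off_eq S c (colour_act d) = off_eq (s @^-1: S) (colour_act c) d.
Proof.
have fE a : face S (hedge_act a) = face (s @^-1: S) a.
  rewrite /face val_hedge_act; apply/subsetP/subsetP => sub x.
    by have := sub (s x); rewrite !inE sK.
  by have := sub (s x); rewrite !inE sK.
apply/forallP/forallP => h a; have := h (hedge_act a).
  by rewrite fE !ffunE hedge_actK.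
by rewrite -fE !ffunE hedge_actK.
Qed.

(** Relabelling permutes the tetrahedra and keeps weights, hence permutes the relations. *)
Lemma balanced_act (R : zmodType) (F : colouring -> R) :
  balanced F -> balanced (fun c => F (colour_act c)).
Proof.
move=> balF S c cS; rewrite (reindex_inj (inv_inj colour_actK)).
rewrite -[RHS](balF (s @^-1: S) (colour_act c)); last first.
  by rewrite card_preimset //; apply: inv_inj.
apply: eq_big => [d|d _]; last by rewrite colour_actK.
by rewrite off_eq_act !wt_colour_act.
Qed.

End Symmetry.

Lemma eq_balanced (R : zmodType) (F G : colouring -> R) :
  balanced F -> balanced G -> F (colour cmin) = G (colour cmin) -> F =1 G.
Proof.
move=> balF balG eFG c; apply/eqP; rewrite -subr_eq0; apply/eqP.
apply: (@balanced_eq0 _ (fun c => F c - G c)); last by rewrite eFG subrr.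
by move=> S d cS; rewrite sumrB balF // balG // subrr.
Qed.

(** The five adjacent transpositions generate the symmetric group on the vertices. *)
Definition swap_nat (j k : nat) : nat :=
  if k == j then j.+1 else if k == j.+1 then j else k.

Definition swap_ord (j : nat) (x : 'I_6) : 'I_6 := inord (swap_nat j x).

Lemma swap_nat_lt j k : (j < 5)%N -> (k < 6)%N -> (swap_nat j k < 6)%N.
Proof.
move=> j5 k6; rewrite /swap_nat; case: eqP => // _; case: eqP => // _.
exact: ltnW.
Qed.

Lemma swap_ordK j : (j < 5)%N -> involutive (swap_ord j).
Proof.
move=> j5 x; apply: val_inj; rewrite /= !inordK ?swap_nat_lt ?inordK ?swap_nat_lt //.
rewrite /swap_nat; have [->|xj] := eqVneq (val x) j.
  by rewrite eqxx -[_ == j]/(j.+1 == j) gtn_eqF.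
have [->|xj1] := eqVneq (val x) j.+1; first by rewrite eqxx.
by rewrite (negPf xj) (negPf xj1).
Qed.

Definition swap_index (j : nat) : seq nat :=
  [seq index (sort leq (map (swap_nat j) (triple i))) triples | i <- iota 0 20].

Lemma hedge_act_swap j i : (j < 5)%N -> (i < 20)%N ->
  hedge_act (swap_ord j) (hedge_of i) = hedge_of (nth 0%N (swap_index j) i).
Proof.
move=> j5 i20.
have chk : all (fun j => all (fun i => let i' := nth 0%N (swap_index j) i in
    (i' < 20)%N && all (fun k => (swap_nat j k \in triple i) == (k \in triple i'))
      (iota 0 6)) (iota 0 20)) (iota 0 5) by vm_compute.
have jI : j \in iota 0 5 by rewrite mem_iota.
have iI : i \in iota 0 20 by rewrite mem_iota.
have /andP[i'20 /allP mE] := allP (allP chk j jI) i iI.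
apply: val_inj; apply/setP => x; rewrite (val_hedge_act (swap_ordK j5)) inE.
rewrite -[in RHS](inord_val x) (mem_hedge_of i'20 (ltn_ord x)).
rewrite /swap_ord (mem_hedge_of i20 (swap_nat_lt j5 (ltn_ord x))).
by apply/eqP; apply: mE; rewrite mem_iota ltn_ord.
Qed.

Lemma swap_index_lt j i : (j < 5)%N -> i \in swap_index j -> (i < 20)%N.
Proof.
move=> j5.
have chk : all (fun j => all (gtn 20) (swap_index j)) (iota 0 5) by vm_compute.
by move: i; apply/allP; apply: (allP chk); rewrite mem_iota.
Qed.

Lemma colour_act_swap j l : (j < 5)%N -> size l = 20%N ->
  colour_act (swap_ord j) (colour l) = colour (restr l (swap_index j)).
Proof.
move=> j5 sl; apply/ffunP => a; have [i i20 ->] := hedge_ofP a.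
have ss : size (swap_index j) = 20%N by rewrite size_map size_iota.
have lt : (nth 0%N (swap_index j) i < 20)%N.
  by apply: (swap_index_lt j5); rewrite mem_nth ?ss.
rewrite ffunE hedge_act_swap // (colour_hedge_of _ lt) (colour_hedge_of _ i20).
by rewrite /restr (nth_map 0%N) ?ss.
Qed.

(** Both sides are balanced, so by uniqueness it is enough to compute them at [cmin]. *)
Lemma eps_det_swap j c : (j < 5)%N ->
  eps_det (colour_act (swap_ord j) c) = eps_det c.
Proof.
move=> j5; move: c; apply: eq_balanced.
- exact: (balanced_act (swap_ordK j5) eps_det_balanced).
- exact: eps_det_balanced.
have sr : size (restr cmin (swap_index j)) = 20%N by rewrite !size_map size_iota.
have sc : size cmin = 20%N by [].
rewrite (colour_act_swap j5 sc) (eps_listE sr) (eps_listE sc).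
have chk : all (fun j => eps_list (restr cmin (swap_index j)) == eps_list cmin)
    (iota 0 5).
  by vm_compute.
by apply/eqP; apply: (allP chk); rewrite mem_iota.
Qed.

(** * The values of the determinant on colourings *)

Definition swap_indices : seq (seq nat) := Eval vm_compute in map swap_index (iota 0 5).

Lemma swap_indicesP pi : pi \in swap_indices ->
  exists2 j, (j < 5)%N & pi = swap_index j.
Proof.
have -> : swap_indices = map swap_index (iota 0 5) by vm_compute.
by move=> /mapP[j]; rewrite mem_iota => j5 ->; exists j.
Qed.

(* The colouring [p], possibly partial, permuted by [pi] is smaller than [q]. *)
Fixpoint ltl_act (p : seq bool) (pi : seq nat) (q : seq bool) : bool :=
  match pi, q with
  | i :: pi', y :: q' =>
      if (i < size p)%N then
        if nth false p i then if y then ltl_act p pi' q' else false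
        else if y then true else ltl_act p pi' q'
      else false
  | _, _ => false
  end.

Lemma ltl_act_cat p pi q s s' : ltl_act p pi q -> ltl (restr (p ++ s) pi) (q ++ s').
Proof.
elim: pi q => [|i pi IH] [|y q] //=; case: ltnP => // ip; rewrite nth_cat ip.
by case: (nth false p i); case: y => //; apply: IH.
Qed.

Definition eps_value (x : int) : bool := x \in [:: -4; -1; 0; 1].

(** A prefix is dropped if it contains a monochromatic tetrahedron (value 0), uses a colour more
    than ten times (wrong weight), or is made smaller by a transposition (same value as a smaller
    colouring). Determinants are computed only for the survivors. *)
Fixpoint all_values (n : nat) (p : seq bool) : bool :=
  if mono p then true else
  if (10 < count id p)%N then true else
  if (10 < count negb p)%N then true else
  if any (fun pi => ltl_act p pi p) swap_indices then true else
  if n is n'.+1 then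
    if all_values n' (rcons p false) then all_values n' (rcons p true) else false
  else eps_value (eps_list p).

Lemma all_values20 : all_values 20 [::].
Proof. by vm_compute. Qed.

Lemma all_valuesP n p s : all_values n p -> size s = n -> size (p ++ s) = 20%N ->
  count id (p ++ s) = 10%N ->
  (forall l, size l = 20%N -> ltl l (p ++ s) -> count id l = 10%N ->
     eps_value (eps_det (colour l))) ->
  eps_value (eps_det (colour (p ++ s))).
Proof.
move=> + + + + small; elim: n p s small => [|n IH] p s small.
all: rewrite /all_values -/all_values.
all: case: ifP => [mp _ _ sps _|_];
  first by rewrite (balanced_mono eps_det_balanced) // -size_cat.
all: case: ifP => [c10 _ _ _ cps|_];
  first by move: c10; rewrite ltnNge -cps count_cat leq_addr.
all: case: ifP => [c10 _ _ sps cps|_].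
all: try by move: sps; rewrite -(count_predC id) cps => /eqP;
  rewrite -[20%N]/(10 + 10)%N eqn_add2l => /eqP c10';
  move: c10; rewrite ltnNge -c10' count_cat leq_addr.
all: case: ifP => [|_];
  first rewrite anyE => /hasP[pi /swap_indicesP[j j5 ->] lt] _ _ sps cps.
(* The transposition keeps both the value and the weight, so the hypothesis on smaller colourings
   applies. *)
all: try by rewrite -(eps_det_swap _ j5) colour_act_swap //; apply: small;
  rewrite ?size_map ?ltl_act_cat // -wt_colour ?size_map // -colour_act_swap //
    (wt_colour_act (swap_ordK j5)) wt_colour.
  by case: s small => // _; rewrite cats0 => v _ sp _; rewrite eps_listE.
case: ifP => // v0 v1; case: s small => // x s; rewrite -cat_rcons => small [sn].
by apply: IH => //; case: x {small}.
Qed.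

Lemma eps_det_value c : eps_value (eps_det c).
Proof.
have [->//|nz] := eqVneq (eps_det c) 0.
suff vals l : size l = 20%N -> count id l = 10%N -> eps_value (eps_det (colour l)).
  by rewrite -[c]lstK; apply: vals; rewrite -?wt_colour ?size_lst // lstK eps_det_wt.
have [n] := ubnP (num l); elim: n l => // n IH l le_n sl cl.
apply: (all_valuesP all_values20 (s := l)) => // l' sl' lt cl'.
by apply: IH => //; apply: leq_trans (ltl_num _ lt) le_n; rewrite sl' sl.
Qed.

(** * Configurations that force the value zero *)

Lemma edgeC (x y z : 'I_6) : edge x y z = edge y x z.
Proof. by rewrite /edge (setUC [set x]). Qed.

Lemma edgeR (x y z : 'I_6) : edge x y z = edge y z x.
Proof. by rewrite /edge -setUA setUC. Qed.

Lemma colouring_eq (c d : colouring) : (forall a, d a -> c a) -> wt d = wt c -> d = c.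
Proof.
move=> le e; have := @leqif_sum _ predT (fun a => d a == c a)
  (fun a => nat_of_bool (d a)) (fun a => nat_of_bool (c a)).
case=> [a _|_].
  by have := le a; case: (d a); case: (c a) => // /(_ isT).
rewrite -/(wt d) -/(wt c) e eqxx => /esym/forallP dc.
by apply/ffunP => a; apply/eqP; apply: dc.
Qed.

Lemma off_eq_edge S (c d : colouring) x y z w : off_eq S c d ->
  uniq [:: x; y; z] -> w \in [:: x; y; z] -> w \notin S ->
  d (edge x y z) = c (edge x y z).
Proof.
move=> /forallP/(_ (edge x y z)) off u wE wS.
suff /negPf nf : ~~ face S (edge x y z) by move: off; rewrite nf => /eqP.
apply: contra wS => /subsetP; apply; rewrite val_edge // !inE -orbA.
by move: wE; rewrite !inE.
Qed.

Section Configurations.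

Variables (R : zmodType) (F : colouring -> R).
Hypothesis F_bal : balanced F.

Definition coloured (b : bool) (c : colouring) (s : seq hedge) : bool :=
  all (fun a => c a == b) s.

(** Any [d] in the relation is pointwise comparable with [c], which is constant on the four faces;
    equal weights then give [d = c]. *)
Lemma balanced_conf_a b c x y z t : uniq [:: x; y; z; t] ->
  coloured b c (tetra x y z t) -> F c = 0.
Proof.
move=> u /allP cb; have cS := card_set4 u.
have := F_bal c cS; rewrite (bigD1 c) /=; last first.
  by rewrite eqxx andbT; apply/forallP => a; rewrite eqxx orbT.
rewrite big1 ?addr0 // => d /andP[/andP[/forallP off /eqP wtd] dc].
have cE a : face [set x; y; z; t] a -> c a = b.
  by rewrite -mem_tetra // => /cb/eqP.
case/negP: dc; apply/eqP; case: b cb cE => _ cE.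
  apply: colouring_eq wtd => a; have := off a.
  by case: (boolP (face _ a)) => [/cE-> //|_ /eqP ->].
apply/esym; apply: colouring_eq (esym wtd) => a; have := off a.
by case: (boolP (face _ a)) => [/cE-> //|_ /eqP ->].
Qed.

(* If three faces of a tetrahedron have the same colour, every other colouring
   in the relation gives that colour to the fourth face. *)
Lemma balanced_three b c x y z t : uniq [:: x; y; z; t] ->
  coloured b c [:: edge x y z; edge x y t; edge x z t] ->
  (forall d, off_eq [set x; y; z; t] c d -> d (edge y z t) = b -> F d = 0) ->
  F c = 0.
Proof.
move=> u /and4P[/eqP c1 /eqP c2 /eqP c3 _] Fd; have cS := card_set4 u.
have [c4|c4] := eqVneq (c (edge y z t)) b.
  by apply: Fd => //; apply/forallP => a; rewrite eqxx orbT.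
have := F_bal c cS; rewrite (bigD1 c) /=; last first.
  by rewrite eqxx andbT; apply/forallP => a; rewrite eqxx orbT.
rewrite big1 ?addr0 // => d /andP[/andP[off /eqP wtd] dc].
apply: Fd => //; apply/eqP; apply: contraNT dc => d4.
have d4c : d (edge y z t) = c (edge y z t) by case: (b) (d _) (c _) c4 d4 => [] [] [].
move/forallP: off => off.
have dE a : c a = b \/ d a = c a.
  have := off a; rewrite -mem_tetra // !inE => /orP[|/eqP]; last by right.
  by case/or4P => /eqP ->; [left|left|left|right].
apply/eqP; case: b {c1 c2 c3 c4 d4} dE => dE.
  by apply: colouring_eq wtd => a; case: (dE a) => ->.
by apply/esym; apply: colouring_eq (esym wtd) => a; case: (dE a) => ->.
Qed.

(** The relation of the tetrahedron xyzt gives colour [b] to yzt, which makes the tetrahedron yztu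
    monochromatic. *)
Lemma balanced_conf_b b c x y z t u : uniq [:: x; y; z; t; u] ->
  coloured b c [:: edge x y z; edge x y t; edge x z t;
                   edge y z u; edge y t u; edge z t u] -> F c = 0.
Proof.
rewrite /= !inE !negb_or -!andbA => /and5P[nxy nxz nxt nxu].
move=> /and5P[nyz nyt nyu nzt /and3P[nzu ntu _]].
have N := (nxy, nxz, nxt, nxu, nyz, nyt, nyu, nzt, nzu, ntu).
rewrite andbT => /and5P[c1 c2 c3 c4 /andP[c5 c6]].
apply: (@balanced_three b c x y z t).
- by rewrite /= !inE !negb_or !N.
- by rewrite /coloured /= c1 c2 c3.
move=> d off d1; have uS : u \notin [set x; y; z; t].
  by rewrite !inE !(eq_sym u) !negb_or !N.
apply: (@balanced_conf_a b d y z t u); first by rewrite /= !inE !negb_or !N.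
rewrite /coloured /= d1 eqxx !(off_eq_edge off _ _ uS) ?c4 ?c5 ?c6 //=.
all: by rewrite !inE ?eqxx ?orbT ?negb_or ?N.
Qed.

(** The relation of uxyz gives colour [b] to xyz, which completes configuration (b) on z, x, y, t,
    v. *)
Lemma balanced_conf_c b c x y z t u v : uniq [:: x; y; z; t; u; v] ->
  coloured b c [:: edge x y u; edge x y v; edge y z u; edge x z u;
                   edge x t v; edge y t v; edge y z t; edge x z t] -> F c = 0.
Proof.
rewrite /= !inE !negb_or -!andbA => /and5P[nxy nxz nxt nxu].
move=> /and5P[nxv nyz nyt nyu /and5P[nyv nzt nzu nzv /and4P[ntu ntv nuv _]]].
have N := (nxy, nxz, nxt, nxu, nxv, nyz, nyt, nyu, nyv, nzt, nzu, nzv, ntu, ntv, nuv).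
have S := (eq_sym y x, eq_sym z x, eq_sym t x, eq_sym u x, eq_sym v x, eq_sym z y,
  eq_sym t y, eq_sym u y, eq_sym v y, eq_sym t z, eq_sym u z, eq_sym v z,
  eq_sym u t, eq_sym v t, eq_sym v u).
rewrite andbT => /and5P[c1 c2 c3 c4 /and4P[c5 c6 c7 c8]].
apply: (@balanced_three b c u x y z).
- by rewrite /= !inE !negb_or ?S !N.
- by rewrite /coloured /= !(edgeR u) c1 c3 c4.
move=> d off d1.
have vS : v \notin [set u; x; y; z] by rewrite !inE !negb_or ?S !N.
have tS : t \notin [set u; x; y; z] by rewrite !inE !negb_or ?S !N.
have offv p q : uniq [:: p; q; v] -> d (edge p q v) = c (edge p q v).
  by move=> u3; apply: off_eq_edge off u3 _ vS; rewrite !inE eqxx !orbT.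
have offt p q : uniq [:: p; q; t] -> d (edge p q t) = c (edge p q t).
  by move=> u3; apply: off_eq_edge off u3 _ tS; rewrite !inE eqxx !orbT.
apply: (@balanced_conf_b b d z x y t v); first by rewrite /= !inE !negb_or ?S !N.
rewrite /coloured /= (edgeR z x y) d1 eqxx (edgeC z x) (edgeC z y).
by rewrite !offv ?offt ?c2 ?c5 ?c6 ?c7 ?c8 //= !inE !negb_or ?N.
Qed.

(** The relation of xyzt gives colour [b] to yzt, which completes configuration (c) on y, v, u, t,
    x, z. *)
Lemma balanced_conf_d b c x y z t u v : uniq [:: x; y; z; t; u; v] ->
  coloured b c [:: edge x y z; edge x y t; edge x z t; edge x y u; edge y t u;
                   edge x y v; edge x u v; edge y z v; edge z t v; edge t u v] ->
  F c = 0.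
Proof.
rewrite /= !inE !negb_or -!andbA => /and5P[nxy nxz nxt nxu].
move=> /and5P[nxv nyz nyt nyu /and5P[nyv nzt nzu nzv /and4P[ntu ntv nuv _]]].
have N := (nxy, nxz, nxt, nxu, nxv, nyz, nyt, nyu, nyv, nzt, nzu, nzv, ntu, ntv, nuv).
have S := (eq_sym y x, eq_sym z x, eq_sym t x, eq_sym u x, eq_sym v x, eq_sym z y,
  eq_sym t y, eq_sym u y, eq_sym v y, eq_sym t z, eq_sym u z, eq_sym v z,
  eq_sym u t, eq_sym v t, eq_sym v u).
rewrite andbT => /and5P[c1 c2 c3 c4 /and5P[c5 c6 c7 c8 /andP[c9 c10]]].
apply: (@balanced_three b c x y z t).
- by rewrite /= !inE !negb_or !N.
- by rewrite /coloured /= c1 c2 c3.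
move=> d off d1.
have vS : v \notin [set x; y; z; t] by rewrite !inE !negb_or ?S !N.
have uS : u \notin [set x; y; z; t] by rewrite !inE !negb_or ?S !N.
have offv p q : uniq [:: p; q; v] -> d (edge p q v) = c (edge p q v).
  by move=> u3; apply: off_eq_edge off u3 _ vS; rewrite !inE eqxx !orbT.
have offu p q : uniq [:: p; q; u] -> d (edge p q u) = c (edge p q u).
  by move=> u3; apply: off_eq_edge off u3 _ uS; rewrite !inE eqxx !orbT.
apply: (@balanced_conf_c b d y v u t x z); first by rewrite /= !inE !negb_or ?S !N.
rewrite /coloured /= -(edgeR x y v) -(edgeR x y u) (edgeR v u x) (edgeC u x v).
rewrite (edgeR v t z) (edgeC t z v) (edgeR v u t) (edgeC u t v).
rewrite (edgeC y v z) (edgeR v y z) (edgeC y t z) (edgeR t y z) d1 eqxx.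
rewrite (edgeC y u t) (edgeR u y t).
by rewrite !offv ?offu ?c4 ?c5 ?c6 ?c7 ?c8 ?c9 ?c10 //= !inE !negb_or ?N.
Qed.

Lemma balanced_has_conf (b : bool) (c : colouring) (H : {set hedge}) :
  (forall a, a \in H -> c a = b) -> has_conf H -> F c = 0.
Proof.
move=> Hb; have col s : contains H s -> coloured b c s.
  by move/allP => Hs; apply/allP => a /Hs/Hb->.
case/or4P.
- case/existsP => x /existsP[y /existsP[z /existsP[t /andP[u /col cs]]]].
  exact: (balanced_conf_a u cs).
- case/existsP => x /existsP[y /existsP[z /existsP[t /existsP[u /andP[un /col cs]]]]].
  exact: (balanced_conf_b un cs).
- case/existsP => x /existsP[y /existsP[z /existsP[t /existsP[u /existsP[v]]]]].
  by case/andP => un /col cs; exact: (balanced_conf_c un cs).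
- case/existsP => x /existsP[y /existsP[z /existsP[t /existsP[u /existsP[v]]]]].
  by case/andP => un /col cs; exact: (balanced_conf_d un cs).
Qed.

End Configurations.

(** * Homogeneous partitions as colourings of weight ten *)

Definition hpart_colouring (P : hpart) : colouring := [ffun a => a \in (val P).2].

Lemma mem_hpart1 (P : hpart) a : (a \in (val P).1) = (a \notin (val P).2).
Proof.
have /and4P[/pred0P dP /eqP uP _ _] := valP P.
have /= := dP a; have := in_setT a; rewrite -uP inE.
by case: (a \in (val P).1); case: (a \in (val P).2).
Qed.

Lemma wt_set (A : {set hedge}) : wt [ffun a => a \in A] = #|A|.
Proof.
rewrite -sum1_card big_mkcond; apply: eq_bigr => a _.
by rewrite ffunE; case: (a \in A).
Qed.

Lemma wt_hpart P : wt (hpart_colouring P) = 10%N.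
Proof. by rewrite wt_set; have /and4P[_ _ _ /eqP] := valP P. Qed.

Lemma hpart_colouring_inj : injective hpart_colouring.
Proof.
move=> P Q /ffunP PQ; apply: val_inj.
have e2 a : (a \in (val P).2) = (a \in (val Q).2) by have := PQ a; rewrite !ffunE.
by apply: injective_projections; apply/setP => a; rewrite ?mem_hpart1 e2.
Qed.

Lemma hpart_colouringP c : wt c = 10%N -> exists P, hpart_colouring P = c.
Proof.
move=> wc; pose A := [set a | c a].
have cA : [ffun a => a \in A] = c by apply/ffunP => a; rewrite ffunE inE.
have A10 : #|A| = 10%N by rewrite -wt_set cA.
have hP : is_hpart (~: A, A).
  rewrite /is_hpart /= A10 eqxx andbT -setI_eq0 setIC setICr eqxx setUC setUCr eqxx /=.
  by rewrite -(eqn_add2l #|A|) cardsC A10 card_hedge.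
by exists (exist (fun Q => is_true (is_hpart Q)) _ hP).
Qed.

Lemma big_hpart (R : nmodType) (C : pred colouring) (f : colouring -> R) :
  \sum_(P | C (hpart_colouring P)) f (hpart_colouring P) =
  \sum_(c | C c && (wt c == 10%N)) f c.
Proof.
rewrite (partition_big hpart_colouring (fun c => C c && (wt c == 10%N))) /=; last first.
  by move=> P ->; rewrite wt_hpart.
apply: eq_bigr => c /andP[Cc /eqP/hpart_colouringP[P Pc]].
rewrite (big_pred1 P) ?Pc // => Q /=; rewrite -Pc (inj_eq hpart_colouring_inj).
by case: eqP => [->|_]; rewrite ?Pc ?Cc ?andbF.
Qed.

Lemma mem_Pair P x y z t K : uniq [:: x; y; z; t] ->
  (K \in Pair P x y z t) =
  off_eq [set x; y; z; t] (hpart_colouring P) (hpart_colouring K).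
Proof.
move=> u; rewrite inE; apply: eq_forallb => a.
rewrite mem_tetra // !ffunE !mem_hpart1 implybE negbK; congr (_ || _).
by case: (a \in _); case: (a \in _).
Qed.

Lemma sum_Pair (R : nmodType) (f : colouring -> R) P x y z t : uniq [:: x; y; z; t] ->
  \sum_(K in Pair P x y z t) f (hpart_colouring K) =
  \sum_(d | off_eq [set x; y; z; t] (hpart_colouring P) d &&
            (wt d == wt (hpart_colouring P))) f d.
Proof.
by move=> u; rewrite wt_hpart -big_hpart; apply: eq_bigl => K; apply: mem_Pair.
Qed.

(** The predecessors shift the vertices from 1, ..., 6 to 0, ..., 5. *)
Definition P1_index : seq nat :=
  [seq index [:: a.1.1.-1; a.1.2.-1; a.2.-1]%N triples | a <- P1_triples].

Lemma P1_colouring :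
  hpart_colouring P1 = colour [seq i \notin P1_index | i <- iota 0 20].
Proof.
apply/ffunP => a; have [i i20 ->] := hedge_ofP a.
rewrite colour_hedge_of // (nth_map 0%N) ?size_iota // nth_iota // add0n.
rewrite ffunE inE inE -[P1_seq]/(map hedge_of P1_index); congr negb.
apply/mapP/idP => [[j jP e]|iP]; last by exists i.
have j20 : (j < 20)%N.
  have chk : all (gtn 20) P1_index by vm_compute.
  exact: (allP chk).
by rewrite (hedge_of_inj _ _ e).
Qed.

Lemma eps_det_P1 : eps_det (hpart_colouring P1) = 1.
Proof. by rewrite P1_colouring eps_listE; vm_compute. Qed.

Lemma eps_det_cmin : eps_det (colour cmin) = 1.
Proof. by rewrite eps_listE; vm_compute. Qed.

Lemma eps_det_is_epsS3 : is_epsS3 [ffun P => eps_det (hpart_colouring P)].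
Proof.
split=> [P|P x y z t xy yz zt|]; last by rewrite ffunE eps_det_P1.
  by rewrite ffunE; apply: eps_det_value.
have u := lt4_uniq xy yz zt.
rewrite -[RHS](eps_det_balanced (hpart_colouring P) (card_set4 u)) -sum_Pair //.
by apply: eq_bigr => K _; rewrite ffunE.
Qed.

(** Since [eps_det] is 1 at [cmin], uniqueness makes every balanced function a multiple of it. *)
Lemma balanced_scale (R : nzRingType) (F : colouring -> R) : balanced F ->
  forall c, F c = F (colour cmin) * (eps_det c)%:~R.
Proof.
move=> balF; apply: eq_balanced => //; last by rewrite eps_det_cmin mulr1.
by move=> S c cS; rewrite -mulr_sumr -rmorph_sum /= eps_det_balanced // mulr0.
Qed.

(** Extended by zero to all colourings, [epsS3] is balanced, hence a multiple of [eps_det]; the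
    normalisation at [P1] makes the factor 1. *)
Lemma epsS3E P : epsS3 P = eps_det (hpart_colouring P).
Proof.
have [_ sum0 eps1] : is_epsS3 epsS3.
  by apply: classical_sets.xgetPex; exists [ffun P => eps_det (hpart_colouring P)];
    apply: eps_det_is_epsS3.
(* The sum has one term in weight ten and none in other weights. *)
pose E c := \sum_(P | hpart_colouring P == c) epsS3 P.
have EP Q : E (hpart_colouring Q) = epsS3 Q.
  by rewrite /E (big_pred1 Q) // => K; rewrite (inj_eq hpart_colouring_inj).
have balE : balanced E.
  move=> S c cS; have [wc|wc] := eqVneq (wt c) 10%N; last first.
    rewrite big1 // => d /andP[_ /eqP wd]; rewrite /E big_pred0 // => K.
    by apply: contraNF wc => /eqP e; rewrite -wd -e wt_hpart.
  have [Q Qc] := hpart_colouringP wc.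
  have [x [y [z [t [[xy yz zt] SE]]]]] := set4P cS.
  rewrite -Qc SE -sum_Pair ?lt4_uniq // -[RHS](sum0 Q x y z t xy yz zt).
  by apply: eq_bigr => K _; rewrite EP.
have scale := balanced_scale balE.
have e1 : E (colour cmin) = 1.
  by have := scale (hpart_colouring P1); rewrite EP eps1 eps_det_P1 mulr1.
by rewrite -EP scale e1 mul1r intz.
Qed.

(** Restricting the sum in [detS3_form] to nontrivial partitions therefore loses no term. *)
Lemma eps_det_trivial P : ~~ nontrivial P -> eps_det (hpart_colouring P) = 0.
Proof.
case/nandP => /negPn h.
  apply: (balanced_has_conf eps_det_balanced (b := false) _ h) => a.
  by rewrite ffunE mem_hpart1 => /negbTE.
by apply: (balanced_has_conf eps_det_balanced (b := true) _ h) => a; rewrite ffunE.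
Qed.

(** * Identification of the form with the determinant, and conclusion *)

Lemma monomialE (k : fieldType) (V : vectType k) (e : 2.-tuple V) P v :
  monomial e P v = \prod_a coord e (colour_ord (hpart_colouring P a)) (v a).
Proof.
rewrite /monomial (bigID (fun a => a \in (val P).1) predT) /=.
congr (_ * _); apply: eq_big => a; rewrite ?mem_hpart1 ?negbK // ffunE.
  by move/negPf ->.
by move=> ->.
Qed.

(** In the expansion of the determinant over colourings, the terms of weight other than ten and
    those of trivial partitions vanish. *)
Lemma detS3_formE (k : fieldType) (V : vectType k) (e : 2.-tuple V) :
  basis_of fullv e -> detS3_form e =1 bracket_det e.
Proof.
move=> eB v; rewrite (multilinear_basis_sum eB (bracket_det_multilinear e)).
pose g (c : colouring) : k :=
  (\prod_a coord e (colour_ord (c a)) (v a)) * bracket_det e (basis_fun e c).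
rewrite -/(g _) (bigID (fun c => wt c == 10%N)) /=.
rewrite [X in _ = _ + X]big1 ?addr0; last first.
  move=> c wc; rewrite bracket_det_basis_fun //.
  case: (eqVneq (eps_det c) 0) => [->|/eps_det_wt wE].
    by rewrite mulr0.
  by rewrite wE eqxx in wc.
rewrite -(big_hpart predT g) /= [RHS](bigID nontrivial) /= [X in _ = _ + X]big1 ?addr0.
  apply: eq_bigr => P _; rewrite /g bracket_det_basis_fun // epsS3E monomialE.
  exact: mulrC.
by move=> P /eps_det_trivial e0; rewrite /g bracket_det_basis_fun // e0 mulr0.
Qed.

Lemma infinite_uniq_seq (k : fieldType) :
  ~ cardinality.finite_set (@classical_sets.setT k) ->
  forall n, exists s : seq k, uniq s /\ size s = n.
Proof.
move=> kinf n; have [B _ Bn] := cardinality.infinite_set_fset n kinf.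
exists (take n (finmap.enum_fset B)); split; last by rewrite size_takel.
exact/take_uniq/finmap.fset_uniq.
Qed.

Theorem theorem4p12
  (k : fieldType)
  (k_infinite : ~ cardinality.finite_set (@classical_sets.setT k))
  (k_char2 : 2%N \notin [pchar k]) (k_char3 : 3%N \notin [pchar k])
  (V : vectType k) (e : 2.-tuple V) (e_basis : basis_of fullv e)
  (T : lmodType k) (tens : {ffun hedge -> V} -> T)
  (T_tensor : is_tensor_power tens)
  (detS3 : {linear T -> k^o})
  (detS3E : forall v : {ffun hedge -> V}, detS3 (tens v) = detS3_form e v) :
  [/\ exists t, detS3 t <> 0,
      vanishes_on_degenerate tens detS3
    & forall f : {linear T -> k^o}, vanishes_on_degenerate tens f ->
        exists c : k, forall t, f t = c * detS3 t] /\
  (forall (L : lmodType k) (proj : {linear T -> L}),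
     is_quotient (ES3 tens) proj ->
     exists D : {linear L -> k^o},
       [/\ forall t, D (proj t) = detS3 t,
           exists q, D q <> 0
         & forall f : {linear L -> k^o}, exists c : k, forall q, f q = c * D q]).
Proof.
have det_tens v : detS3 (tens v) = bracket_det e v by rewrite detS3E detS3_formE.
have tensL (f : {linear T -> k^o}) : multilinear (fun v => f (tens v)).
  by move=> i v a x y; rewrite T_tensor.1 linearP.
have linear_ext (f g : {linear T -> k^o}) :
    (forall v, f (tens v) = g (tens v)) -> f =1 g.
  have [h [_ hU]] := T_tensor.2 _ _ (tensL g).
  by move=> fg t; rewrite (hU f fg) (hU g).
have nz : exists t, detS3 t <> 0.
  exists (tens (basis_fun e (colour cmin))).
  by rewrite det_tens bracket_det_basis_fun // eps_det_cmin; apply/eqP/oner_neq0.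
have van : vanishes_on_degenerate tens detS3.
  by move=> v /(bracket_det_degenerate e) v0; rewrite det_tens.
have uni (f : {linear T -> k^o}) : vanishes_on_degenerate tens f ->
    exists c : k, forall t, f t = c * detS3 t.
  (* The constant is the value of [f] at the basis tensor where [detS3] is 1. *)
  move=> fvan; exists (f (tens (basis_fun e (colour cmin)))).
  set a := f _; pose g : {linear T -> k^o} := (a \*: detS3)%R.
  have gE t : g t = a * detS3 t by [].
  move=> t; rewrite -gE; move: t; apply: linear_ext.
  apply: (multilinear_ext e_basis (tensL f) (tensL g)) => c.
  pose d : colouring := [ffun x => c x == 1].
  have -> : [ffun x => tnth e (c x)] = basis_fun e d.
    apply/ffunP => x; rewrite !ffunE (tnth_nth 0); congr (_`_ _).
    by case: (c x) => [[|[|]]] //= i2; rewrite -val_eqE.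
  rewrite gE det_tens bracket_det_basis_fun //.
  have balF := multilinear_balanced e_basis (infinite_uniq_seq k_infinite)
    (tensL f) fvan.
  exact: (balanced_scale balF).
split=> // L proj [surj ker].
have surjb q : exists t, proj t == q by have [t <-] := surj q; exists t.
(* The value at a chosen preimage; it does not depend on the choice because [detS3] vanishes on the
   kernel of [proj]. *)
pose D0 q : k^o := detS3 (xchoose (surjb q)).
have ker0 t : proj t = 0 -> detS3 t = 0.
  move/ker => [n [c [s [sv ->]]]]; rewrite linear_sum big1 // => i _.
  by have [v vdeg ->] := sv i; rewrite linearZ /= van // scaler0.
have D0E t : D0 (proj t) = detS3 t.
  apply/eqP; rewrite -subr_eq0 /D0 -linearB; apply/eqP; apply: ker0.
  by rewrite linearB (eqP (xchooseP (surjb (proj t)))) subrr.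
have D0L : linear D0.
  move=> a q r; have [t <-] := surj q; have [u <-] := surj r.
  by rewrite -linearP !D0E linearP.
pose DM := GRing.isLinear.Build k L k^o *:%R D0 D0L.
pose D : {linear L -> k^o} := HB.pack D0 DM.
have DE t : D (proj t) = detS3 t by exact: D0E.
exists D; split=> //; first by have [t nzt] := nz; exists (proj t); rewrite DE.
move=> f; pose fp : {linear T -> k^o} := (f \o proj)%FUN.
have [|c fc] := uni fp.
  move=> v vdeg; rewrite /fp /=; suff -> : proj (tens v) = 0 by rewrite linear0.
  (* A degenerate simple tensor is a combination of length one, so [proj] kills it. *)
  apply/ker; exists 1%N, (fun=> 1), (fun=> tens v); split; first by move=> _; exists v.
  by rewrite big_ord1 scale1r.
by exists c => q; have [t <-] := surj q; rewrite DE -fc.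
Qed.
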